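(* The reducible locus $\mathcal{R}_4\subset\mathcal{U}_4$ is smooth and irreducible of dimension $5$, hence of codimension $2$ in $\mathcal{U}_4$.
   Context: For $a_1,\ldots,a_n,c_1,\ldots,c_{n-1}\in\mathbb{C}$, the polynomial $P_n(\lambda,t)\in\mathbb{C}[\lambda,t]$ is defined by $P_0=1$, $P_1=\lambda+a_1$, $P_k=(\lambda+a_k)P_{k-1}-t\,c_{k-1}P_{k-2}$ for $2\le k\le n$, and $\chi_n(\lambda,w)=P_n(\lambda,w^2)$. The principal stratum is \[\mathcal{U}_n=\{(a,c)\in\mathbb{C}^{2n-1}: a_i\neq a_j\ (i\neq j),\ c_1\cdots c_{n-1}\neq 0\},\] with coordinates $a=(a_1,\ldots,a_n)$ and $c=(c_1,\ldots,c_{n-1})$. The reducible locus $\mathcal{R}_n\subset\mathcal{U}_n$ is the set of $(a,c)\in\mathcal{U}_n$ for which $\chi_n(\lambda,w)$ is reducible in $\mathbb{C}[\lambda,w]$. *)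

(* Defs.v *)
From HB Require Import structures.
From mathcomp Require Import all_boot all_order all_algebra.
From mathcomp Require Import boolp classical_sets reals.
From mathcomp Require Import complex mpoly.
Set Implicit Arguments.
Unset Strict Implicit.
Unset Printing Implicit Defensive.
Import Order.TTheory GRing.Theory Num.Theory.
Local Open Scope classical_set_scope.
Local Open Scope ring_scope.

Section Zariski.
Variables (K : closedFieldType) (m : nat).
Implicit Types (X Y Z F : set 'rV[K]_m) (x v : 'rV[K]_m) (d : nat).

Definition zero_set (I : set {mpoly K[m]}) : set 'rV[K]_m :=
  [set x | forall f, I f -> f.@[x 0] = 0].

Definition vanishing_ideal X : set {mpoly K[m]} :=
  [set f | forall x, X x -> f.@[x 0] = 0].

Definition zariski_closed F := exists I, F = zero_set I.

Definition closed_in X Z := exists2 F, zariski_closed F & Z = X `&` F.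

Definition locally_closed X :=
  exists F G, [/\ zariski_closed F, zariski_closed G & X = F `\` G].

(* Irreducibility of X for the subspace topology, stated with closed subsets of
   the ambient affine space. *)
Definition zariski_irreducible X :=
  X !=set0 /\ forall F G, zariski_closed F -> zariski_closed G ->
    X `<=` F `|` G -> X `<=` F \/ X `<=` G.

(* S 0, ..., S d is a chain of length d; the values of S beyond d are junk. *)
Definition irr_chain X d (S : nat -> set 'rV[K]_m) :=
  (forall i, (i <= d)%N -> closed_in X (S i) /\ zariski_irreducible (S i)) /\
  (forall i, (i < d)%N -> S i `<` S i.+1).

Definition is_greatest (P : nat -> Prop) d :=
  P d /\ forall e, P e -> (e <= d)%N.

Definition has_dim X d :=
  is_greatest (fun e => exists S, irr_chain X e S) d.

(* Krull dimension of the local ring of X at x: its primes correspond to the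
   irreducible closed subsets of X passing through x. *)
Definition has_local_dim X x d :=
  is_greatest (fun e => exists2 S, irr_chain X e S & S 0%N x) d.

(* In particular Y is required to be closed in X and irreducible. *)
Definition has_codim Y X d :=
  is_greatest (fun e => exists2 S, irr_chain X e S & S 0%N = Y) d.

(* Vectors killed by the differential at x of every polynomial vanishing on X;
   for X locally closed and x in X this is the Zariski tangent space. *)
Definition tangent_space X x : set 'rV[K]_m :=
  [set v | forall f, vanishing_ideal X f ->
     \sum_(i < m) (mderiv i f).@[x 0] * v 0 i = 0].

Definition smooth X :=
  locally_closed X /\ forall x, X x ->
    exists T : {vspace 'rV[K]_m},
      (forall v, v \in T <-> tangent_space X x v) /\ has_local_dim X x (\dim T).

End Zariski.

Definition reducible (A : idomainType) (p : A) :=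
  [/\ p != 0, p \isn't a GRing.unit &
      exists f g, [/\ f \isn't a GRing.unit, g \isn't a GRing.unit & p = f * g]].

Section Strata.
Variable K : closedFieldType.

(* C[lambda, t] and C[lambda, w] are {poly {poly K}}: lambda is the outer
   variable 'X, and t or w is the inner one, 'X%:P. Indices of a and c are
   1-based. *)
Fixpoint Ppoly (a c : nat -> K) (k : nat) : {poly {poly K}} :=
  match k with
  | 0 => 1
  | S k1 =>
      match k1 with
      | 0 => 'X + (a 1%N)%:P%:P
      | S k2 => ('X + (a k)%:P%:P) * Ppoly a c k1
                - 'X%:P * (c k1)%:P%:P * Ppoly a c k2
      end
  end.

Definition chi (a c : nat -> K) (n : nat) : {poly {poly K}} :=
  map_poly (fun q : {poly K} => q \Po 'X^2) (Ppoly a c n).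

(* The k-th entry of v counted from 1; 0 for k > m. *)
Definition entry (m : nat) (v : 'rV[K]_m) (k : nat) : K :=
  if insub k.-1 is Some i then v 0 i else 0.

(* A point of K^(2n-1) is the row vector (a_1, ..., a_n, c_1, ..., c_(n-1)). *)
Definition stratum (n : nat) : set 'rV[K]_(n + n.-1) :=
  [set x | (forall i j, i != j -> lsubmx x 0 i != lsubmx x 0 j) /\
           \prod_(i < n.-1) rsubmx x 0 i != 0].

Definition reducible_locus (n : nat) : set 'rV[K]_(n + n.-1) :=
  [set x | stratum x /\ reducible (chi (entry (lsubmx x)) (entry (rsubmx x)) n)].

End Strata.

(* Main.v *)
Require Import Defs.
From HB Require Import structures.
From mathcomp Require Import all_boot all_order all_algebra.
From mathcomp Require Import boolp classical_sets functions reals.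
From mathcomp Require Import polyXY separable complex mpoly.
From mathcomp Require Import ring zify.
Set Implicit Arguments.
Unset Strict Implicit.
Unset Printing Implicit Defensive.
Import Order.TTheory GRing.Theory Num.Theory.
Local Open Scope classical_set_scope.
Local Open Scope ring_scope.

(** Write A_i = lambda + a_i.  Then
<<
  chi_4 = A_1 A_2 A_3 A_4 - w^2 (c_1 A_3 A_4 + c_2 A_1 A_4 + c_3 A_1 A_2)
          + w^4 c_1 c_3.
>>
    Equations of the reducible locus.  As a polynomial in w over K[lambda],
    chi_4 has a constant leading coefficient and a squarefree constant term,
    and it is even; comparing coefficients in w ([even_factors]), every proper
    factorization is of the form (f - al w^2) (g - be w^2) with f and g
    quadratic in lambda, f g = A_1 A_2 A_3 A_4 and al be = c_1 c_3.  So f is, up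
    to a scalar, one of the products A_i A_j.  Evaluating at the -a_i excludes
    the pairings 12|34 and 13|24, and turns the pairing 14|23 into the two
    equations [eqn1] and [eqn2].  On the stratum these say that c is given by
<<
  c_1 = u (a_2 - a_1) (a_4 - a_1),   c_2 = u (a_4 - a_2) (a_3 - a_1),
  c_3 = u (a_4 - a_3) (a_4 - a_1)
>>
    with u != 0, and conversely chi_4 then factors explicitly.  The locus is
    thus the bijective image of an open subset of the 5-dimensional affine
    space of the (a, u), by a polynomial map whose inverse is regular on the
    stratum.

    Irreducibility.  A nonempty set in which any two points are joined by a polynomial
    curve lying in it except at finitely many parameters is irreducible, because
    the pullback of a polynomial along such a curve is a polynomial in one
    variable ([zariski_irreducible_curves]).  Images of lines in the parameters
    are such curves, for the locus, for its slices at fixed values of some of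
    the a_i, for the hypersurface [eqn1] = 0 of the stratum and for the stratum.

    Dimension.  Let [trdeg] X be the largest number of coordinates that are
    algebraically independent on X.  It increases strictly along strict
    inclusions of irreducible closed sets ([trdeg_ltn]): for a maximal
    independent set S of coordinates on Y, each polynomial is, up to a factor in
    K[S] that is not identically zero on Y, integral over K[S] modulo the ideal of
    Y; the constant term of an integral equation of a polynomial that vanishes on X
    but not on Y is then a relation on X between the coordinates in S.  Through
    each point of the locus there is a chain of slices of length 5 ending at the
    locus, and the locus lies below the hypersurface [eqn1] = 0 and the stratum
    in a chain of length 2 in the 7-dimensional space.  Hence [trdeg] equals 5
    on the locus, which gives the dimension, all local dimensions and the
    codimension.

    Smoothness.  The differentials of the two equations are linearly independent
    at each point of the locus, and each vector of their common kernel is the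
    velocity of a curve in the locus, so the tangent space is that kernel, of
    dimension 5. *)

(** * Ring morphisms on multivariate polynomials *)

Section MpolyInduction.
Variables (K : comNzRingType) (m : nat).

Lemma mpoly_ring_ind (P : {mpoly K[m]} -> Prop) :
  (forall c, P c%:MP) -> (forall i, P 'X_i) ->
  (forall p q, P p -> P q -> P (p + q)) ->
  (forall p q, P p -> P q -> P (p * q)) -> forall p, P p.
Proof.
move=> PC PX PD PM p0; elim/mpolyind: p0 => [|c M p _ _ Pp].
  by rewrite -mpolyC0.
apply: PD => //; rewrite -mul_mpolyC; apply: (PM) => //.
rewrite mpolyXE_id; apply: (big_rec P) => [|i q _ Pq]; first by rewrite -mpolyC1.
apply: (PM) => //; elim: (M i) => [|n IHn]; first by rewrite expr0 -mpolyC1.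
by rewrite exprS; apply: PM.
Qed.

Lemma mpoly_rmorph_eq (S : nzRingType) (f g : {rmorphism {mpoly K[m]} -> S}) :
  (forall c, f c%:MP = g c%:MP) -> (forall i, f 'X_i = g 'X_i) -> f =1 g.
Proof.
move=> eqC eqX; elim/mpoly_ring_ind => // p q IHp IHq.
  by rewrite !rmorphD IHp IHq.
by rewrite !rmorphM IHp IHq.
Qed.

End MpolyInduction.

(** * Algebraic independence of coordinates and chains of irreducible sets *)

(** The equation for lc(q) x is obtained from that for x by multiplying it by a
    power of lc(q). *)
Lemma integral_lead_coef_mul (A B : comNzRingType) (phi : {rmorphism A -> B})
    (q : {poly A}) (x : B) :
  (1 < size q)%N -> (map_poly phi q).[x] = 0 ->
  integralOver phi (phi (lead_coef q) * x).
Proof.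
move=> q_gt1 qx0; set g := lead_coef q.
have [d sz_q] : exists d, size q = d.+2 by exists (size q).-2; lia.
(* If q has degree d + 1 and g = lc(q), then 'X^(d+1) + r takes at g x the value
   g^d q(x). *)
pose r := \poly_(i < d.+1) (q`_i * g ^+ (d - i)).
have lt_r : (size r < size ('X^(d.+1) : {poly A}))%N.
  by rewrite size_polyXn ltnS size_poly.
exists ('X^(d.+1) + r); first by rewrite monicE lead_coefDl // lead_coefXn.
apply/rootP.
have -> : map_poly phi ('X^(d.+1) + r)
   = 'X^(d.+1) + \poly_(i < d.+1) (phi q`_i * phi g ^+ (d - i)).
  rewrite rmorphD /= map_polyXn; congr (_ + _); apply/polyP => i.
  rewrite coef_map !coef_poly /=; case: ifP => _; last by rewrite rmorph0.
  by rewrite /= rmorphM rmorphXn.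
rewrite hornerD hornerXn horner_poly.
have e0 : \sum_(i < d.+2) phi q`_i * x ^+ i = 0.
  rewrite -[RHS]qx0 (@horner_coef_wide _ d.+2); last by rewrite -sz_q size_poly.
  by apply: eq_bigr => i _; rewrite coef_map.
transitivity (phi g ^+ d * \sum_(i < d.+2) phi q`_i * x ^+ i).
  rewrite [in RHS]big_ord_recr /= mulrDr addrC; congr (_ + _).
    rewrite mulr_sumr; apply: eq_bigr => i _.
    have -> : phi g ^+ d = phi g ^+ (d - i) * phi g ^+ i.
      by rewrite -exprD subnK // -ltnS.
    by rewrite exprMn; ring.
  have -> : q`_d.+1 = g by rewrite /g lead_coefE sz_q.
  by rewrite exprMn exprS; ring.
by rewrite e0 mulr0.
Qed.

Section TranscendenceDegree.
Variables (K : closedFieldType) (m : nat).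
Implicit Types (X Y : set 'rV[K]_m) (S : {set 'I_m}) (p : {mpoly K[m]}).

(** The retraction of K[X_1, ..., X_m] onto K[S] that kills the variables outside
    S.  The elements of K[S] are represented as its values. *)
Definition restr_vars S : {mpoly K[m]} -> {mpoly K[m]} :=
  mmap (@mpolyC m K) (fun i => if i \in S then 'X_i else 0).
HB.instance Definition _ S := GRing.RMorphism.on (restr_vars S).

Lemma restr_varsC S c : restr_vars S c%:MP = c%:MP.
Proof. exact: mmapC. Qed.

Lemma restr_varsX S i : restr_vars S 'X_i = if i \in S then 'X_i else 0.
Proof. by rewrite /restr_vars mmapX mmap1U. Qed.

(** The coordinates in S are algebraically independent on X. *)
Definition indep S X :=
  forall p, vanishing_ideal X (restr_vars S p) -> restr_vars S p = 0.

(** For an irreducible X this is the transcendence degree of the coordinate ring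
    of X, measured with sets of coordinates only. *)
Definition trdeg X := \max_(S : {set 'I_m} | `[< indep S X >]) #|S|.

Lemma trdeg_le X : (trdeg X <= m)%N.
Proof. by apply/bigmax_leqP => S _; rewrite -[leqRHS]card_ord max_card. Qed.

Lemma trdeg_ge S X : indep S X -> (#|S| <= trdeg X)%N.
Proof.
move=> iS; apply: (@leq_bigmax_cond _ _ (fun S : {set 'I_m} => #|S|)).
exact/asboolP.
Qed.

Lemma indep_subset S X Y : X `<=` Y -> indep S X -> indep S Y.
Proof. by move=> XY iS p Yp; apply: iS => x /XY; apply: Yp. Qed.

Lemma trdeg_subset X Y : X `<=` Y -> (trdeg X <= trdeg Y)%N.
Proof.
move=> XY; apply/bigmax_leqP => S /asboolP iS.
exact/trdeg_ge/(indep_subset XY).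
Qed.

Lemma indep0 X : X !=set0 -> indep finset.set0 X.
Proof.
case=> x Xx p; have [c ->] : exists c, restr_vars finset.set0 p = c%:MP.
  elim/mpoly_ring_ind: p => [c|i|p q [a IHp] [b IHq]|p q [a IHp] [b IHq]].
  - by exists c; rewrite restr_varsC.
  - by exists 0; rewrite restr_varsX inE mpolyC0.
  - by exists (a + b); rewrite rmorphD /= IHp IHq mpolyCD.
  - by exists (a * b); rewrite rmorphM /= IHp IHq mpolyCM.
by move=> /(_ x Xx); rewrite mevalC => ->; rewrite mpolyC0.
Qed.

Lemma trdeg_attained X : X !=set0 -> exists2 S, indep S X & #|S| = trdeg X.
Proof.
move=> /indep0 i0.
have : (0 < #|[pred S : {set 'I_m} | `[< indep S X >]]|)%N.
  by apply/card_gt0P; exists finset.set0; exact/asboolP.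
case/(eq_bigmax_cond (fun S : {set 'I_m} => #|S|)) => S /asboolP iS eS.
by exists S => //; rewrite -eS.
Qed.

Lemma zariski_irreducible_prime X f g : zariski_irreducible X ->
  vanishing_ideal X (f * g) -> vanishing_ideal X f \/ vanishing_ideal X g.
Proof.
case=> _ irrX Xfg.
have cl h : zariski_closed (zero_set [set h : {mpoly K[m]}]) by exists [set h].
case: (irrX _ _ (cl f) (cl g)).
- move=> x /Xfg /eqP; rewrite mevalM mulf_eq0.
  by case/orP => /eqP e; [left|right] => _ ->.
- by move=> XF; left => x /XF; apply.
- by move=> XG; right => x /XG; apply.
Qed.

(** A copy of the affine space with a base point, so that the functions on it
    form a nonzero ring. *)
Definition affine_space := 'rV[K]_m.
HB.instance Definition _ := Choice.on affine_space.
HB.instance Definition _ := isPointed.Build affine_space 0.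

(** The restriction of a polynomial to Y, as a function on the whole space: the
    points outside Y are given the value at y0.  For y0 in Y the kernel is the
    vanishing ideal of Y, so that the image is the coordinate ring of Y. *)
Definition eval_on Y (y0 : 'rV[K]_m) p : affine_space -> K :=
  fun y => p.@[(if `[< Y y >] then y else y0) 0].

Lemma eval_on_zmod Y y0 : zmod_morphism (eval_on Y y0).
Proof. by move=> p q; apply/funext => y; rewrite /eval_on mevalB. Qed.
HB.instance Definition _ Y y0 :=
  GRing.isZmodMorphism.Build _ _ (eval_on Y y0) (eval_on_zmod Y y0).
Lemma eval_on_monoid Y y0 : monoid_morphism (eval_on Y y0).
Proof.
by split=> [|p q]; apply/funext => y; rewrite /eval_on ?meval1 ?mevalM.
Qed.
HB.instance Definition _ Y y0 :=
  GRing.isMonoidMorphism.Build _ _ (eval_on Y y0) (eval_on_monoid Y y0).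

Lemma eval_on_eq0 Y y0 p : Y y0 -> eval_on Y y0 p = 0 <-> vanishing_ideal Y p.
Proof.
move=> Yy0; split=> [e y Yy|Yp].
  have := congr1 (@^~ y) e; rewrite /eval_on; case: asboolP => //.
by apply/funext => y; apply: Yp; case: asboolP.
Qed.

(** Over K[S] modulo the ideal of Y, with S a maximal independent set of
    coordinates, each polynomial becomes integral after multiplication by some
    element of K[S] that is not identically zero on Y. *)
Lemma integral_mod_maximal_indep S Y y0 :
  zariski_irreducible Y -> Y y0 -> indep S Y ->
  (forall j, j \notin S -> ~ indep (j |: S)%SET Y) ->
  forall f, exists2 g, ~ vanishing_ideal Y (restr_vars S g) &
    integralOver (eval_on Y y0 \o restr_vars S)
                 (eval_on Y y0 (restr_vars S g * f)).
Proof.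
move=> irrY Yy0 iS maxS.
have nv1 : ~ vanishing_ideal Y (restr_vars S 1).
  by move=> /(_ y0 Yy0)/eqP; rewrite rmorph1 meval1 oner_eq0.
have nvM p q : ~ vanishing_ideal Y (restr_vars S p) ->
    ~ vanishing_ideal Y (restr_vars S q) ->
    ~ vanishing_ideal Y (restr_vars S (p * q)).
  by rewrite rmorphM => np nq /(zariski_irreducible_prime irrY) [].
have int_restr g : integralOver (eval_on Y y0 \o restr_vars S)
                 (eval_on Y y0 (restr_vars S g)) by exact: integral_id.
have inC f : integralOver (eval_on Y y0 \o restr_vars S) (eval_on Y y0 f) ->
  exists2 g, ~ vanishing_ideal Y (restr_vars S g) &
    integralOver (eval_on Y y0 \o restr_vars S)
                 (eval_on Y y0 (restr_vars S g * f)).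
  move=> H; exists 1; last by rewrite rmorph1 mul1r.
  exact: nv1.
elim/mpoly_ring_ind => [c|j|p q [g Hg Ig] [h Hh Ih]|p q [g Hg Ig] [h Hh Ih]].
- by apply: inC; rewrite -(restr_varsC S).
- have [jS|jS] := boolP (j \in S).
    by apply: inC; rewrite -['X_j](_ : restr_vars S 'X_j = _) // restr_varsX jS.
  have /existsNP [h /not_implyP [Yh nh]] := maxS j jS.
  (* sg h is the relation h, a polynomial in X_j with coefficients in K[S]. *)
  pose sg := mmap (polyC \o @mpolyC m K)
    (fun i => if i == j then 'X else if i \in S then ('X_i)%:P else 0).
  pose q : {poly {mpoly K[m]}} := sg h.
  have qX : q.['X_j] = restr_vars (j |: S)%SET h.
    apply: (mpoly_rmorph_eq (f := horner_eval 'X_j \o sg)) => [c|i] /=.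
      by rewrite restr_varsC /sg mmapC /= horner_evalE hornerC.
    rewrite restr_varsX /sg mmapX mmap1U horner_evalE !inE.
    case: eqP => [->|_] /=; first by rewrite hornerX.
    by case: ifP; rewrite hornerC.
  have qS : map_poly (restr_vars S) q = q.
    apply: (mpoly_rmorph_eq (f := map_poly (restr_vars S) \o sg)
                            (g := sg)) => [c|i] /=.
      by rewrite /sg mmapC /= map_polyC /= restr_varsC.
    rewrite /sg mmapX mmap1U; case: eqP => _; first by rewrite map_polyX.
    by case: ifP => iS'; rewrite ?map_polyC /= ?restr_varsX ?iS' // rmorph0.
  have q0 : q != 0 by apply: contra_notN nh => /eqP q0; rewrite -qX q0 horner0.
  have lqS : restr_vars S (lead_coef q) = lead_coef q.
    by rewrite lead_coefE -[in LHS]coef_map qS.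
  exists (lead_coef q).
    by move=> /iS /eqP; rewrite lqS lead_coef_eq0 (negPf q0).
  rewrite rmorphM; apply: integral_lead_coef_mul.
    (* A relation of degree 0 in X_j would be a relation between the coordinates
       in S. *)
    rewrite ltnNge; apply: contra_notN nh => /size1_polyC q_const.
    have : restr_vars S q`_0 = 0.
      apply: iS => y Yy; rewrite -coef_map qS.
      by have := Yh y Yy; rewrite -qX q_const hornerC coefC.
    by rewrite -coef_map qS => e; rewrite -qX q_const e hornerC.
  rewrite map_poly_comp qS horner_map qX.
  by apply/eval_on_eq0.
- exists (g * h); first exact: nvM.
  rewrite [restr_vars S (g * h)]rmorphM mulrDr rmorphD; apply: integral_add.
    by rewrite mulrAC rmorphM; apply: integral_mul => //; apply: int_restr.
  by rewrite -mulrA rmorphM; apply: integral_mul => //; apply: int_restr.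
- exists (g * h); first exact: nvM.
  by rewrite [restr_vars S (g * h)]rmorphM mulrACA rmorphM; apply: integral_mul.
Qed.

(** The strict form of the monotonicity of dimension, proved without the exchange
    lemma for transcendence bases. *)
Lemma trdeg_ltn X Y f : zariski_irreducible X -> zariski_irreducible Y ->
  X `<=` Y -> vanishing_ideal X f -> ~ vanishing_ideal Y f ->
  (trdeg X < trdeg Y)%N.
Proof.
move=> [X0 _] irrY XY Xf nYf.
have [S iSX <-] := trdeg_attained X0.
have iSY := indep_subset XY iSX.
have [[j jS /trdeg_ge]|maxS] :=
    pselect (exists2 j, j \notin S & indep (j |: S)%SET Y).
  by rewrite cardsU1 jS.
have [x Xx] := X0; have Yx := XY x Xx.
have {}maxS j : j \notin S -> ~ indep (j |: S)%SET Y.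
  by move=> jS ij; apply: maxS; exists j.
have [g Yg [p pm /rootP pr]] := integral_mod_maximal_indep irrY Yx iSY maxS f.
exfalso; move: pr; rewrite map_poly_comp horner_map => /(eval_on_eq0 _ Yx).
set u := _ * f.
have Xu : vanishing_ideal X u by move=> z Xz; rewrite /u mevalM Xf ?mulr0.
have nYu : ~ vanishing_ideal Y u by move=> /(zariski_irreducible_prime irrY) [].
have restrK q : restr_vars S (restr_vars S q) = restr_vars S q.
  apply: (mpoly_rmorph_eq (f := restr_vars S \o restr_vars S)) => [c|i] /=.
    by rewrite !restr_varsC.
  by rewrite restr_varsX; case: ifP => [iS|]; rewrite ?restr_varsX ?iS ?rmorph0.
have : map_poly (restr_vars S) p != 0 by rewrite monic_neq0 // monic_map.
have : map_poly (restr_vars S) (map_poly (restr_vars S) p)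
       = map_poly (restr_vars S) p.
  by apply/polyP => i; rewrite !coef_map /= restrK.
move: (map_poly (restr_vars S) p) => {pm}{}p.
(* By induction on its size, no nonzero polynomial over K[S] has u as a root on Y:
   as u vanishes on X, the constant term vanishes on X, hence is 0, and a factor
   u can be cancelled. *)
have [n] := ubnP (size p); elim: n p => // n IHn p; rewrite ltnS.
move=> sz_p pS p0 Yp.
have pe : p = drop_poly 1 p * 'X + (p`_0)%:P.
  rewrite -[LHS](poly_take_drop 1) addrC expr1; congr (_ + _).
  by apply/polyP => i; rewrite coef_take_poly coefC; case: i.
have p00 : p`_0 = 0.
  have p0S : restr_vars S p`_0 = p`_0 by rewrite -coef_map pS.
  rewrite -p0S; apply: iSX; rewrite p0S => z Xz.
  have := Yp z (XY z Xz); rewrite {1}pe hornerD hornerMX hornerC.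
  by rewrite mevalD mevalM (Xu z Xz) mulr0 add0r.
apply: (IHn (drop_poly 1 p)).
- rewrite size_drop_poly; have : (0 < size p)%N by rewrite size_poly_gt0.
  by lia.
- by apply/polyP => i; rewrite coef_map !coef_drop_poly -coef_map pS.
- by apply: contraNneq p0 => d0; rewrite pe d0 p00 mul0r addr0.
- have : vanishing_ideal Y ((drop_poly 1 p).[u] * u).
    by move: Yp; rewrite {1}pe p00 hornerD hornerMX hornerC addr0.
  by case/(zariski_irreducible_prime irrY).
Qed.

Lemma irr_chain_trdeg X d (S : nat -> set 'rV[K]_m) :
  irr_chain X d S -> (trdeg (S 0%N) + d <= trdeg (S d))%N.
Proof.
case=> irrS ltS.
suff : forall i, (i <= d)%N -> (trdeg (S 0%N) + i <= trdeg (S i))%N by apply.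
elim=> [|i IHi] lid; first by rewrite addn0.
apply: (@leq_trans (trdeg (S i)).+1); first by rewrite addnS ltnS IHi // ltnW.
have [[F [I ->] Si] irrSi] := irrS i (ltnW lid).
have [[F' [I' ->] Si'] irrSi'] := irrS i.+1 lid.
have [sub nsub] := ltS i lid.
have [y /not_implyP [Siy nSy]] : exists y, ~ (S i.+1 y -> S i y).
  exact/existsNP.
have Xy : X y by move: Siy; rewrite Si' => -[].
have /existsNP [f /not_implyP [If fy]] : ~ zero_set I y.
  by move=> Iy; apply: nSy; rewrite Si.
apply: (@trdeg_ltn _ _ f) => //.
  by rewrite Si => x [_ /(_ f If)].
by move=> /(_ y Siy).
Qed.

End TranscendenceDegree.

(** * Polynomial curves *)

Section Curves.
Variables (K : closedFieldType) (m : nat).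
Implicit Types (X Y : set 'rV[K]_m) (f : {mpoly K[m]}) (g : 'I_m -> {poly K}).

(** The pullback of a polynomial along the curve t |-> ((g i).[t])_i. *)
Definition pullback g : {mpoly K[m]} -> {poly K} := mmap polyC g.
HB.instance Definition _ g := GRing.RMorphism.on (pullback g).

Lemma pullbackX g i : pullback g 'X_i = g i.
Proof. by rewrite /pullback mmapX mmap1U. Qed.

Lemma horner_pullback g f t : (pullback g f).[t] = f.@[fun i => (g i).[t]].
Proof.
apply: (mpoly_rmorph_eq (f := horner_eval t \o pullback g)
          (g := meval (fun i => (g i).[t]))) => [c|i] /=.
  by rewrite /pullback mmapC mevalC horner_evalE hornerC.
by rewrite pullbackX mevalXU.
Qed.

Lemma deriv_pullback g f :
  (pullback g f)^`() = \sum_(i < m) pullback g (mderiv i f) * (g i)^`().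
Proof.
elim/mpoly_ring_ind: f => [c|j|p q IHp IHq|p q IHp IHq].
- rewrite /pullback mmapC derivC big1 // => i _.
  by rewrite mderivC rmorph0 mul0r.
- rewrite pullbackX (bigD1 j) //= big1 => [|i ij].
    rewrite mderivX mnmE eqxx scale1r -{1}[U_(j)%MM]add0m addmK mpolyX0.
    by rewrite rmorph1 mul1r addr0.
  by rewrite mderivX mnmE eq_sym (negPf ij) scale0r rmorph0 mul0r.
- rewrite rmorphD derivD IHp IHq -big_split; apply: eq_bigr => i _.
  by rewrite mderivD rmorphD mulrDl.
- rewrite rmorphM derivM IHp IHq mulr_suml mulr_sumr -big_split.
  apply: eq_bigr => i _; rewrite mderivM rmorphD !rmorphM /=; ring.
Qed.

(** A nonempty set is irreducible if any two of its points are the values at 0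
    and 1 of a curve that lies in the set outside the roots of some h. *)
Lemma zariski_irreducible_curves X : X !=set0 ->
  (forall x y, X x -> X y -> exists g, exists h : {poly K},
     [/\ h != 0, forall i, (g i).[0] = x 0 i, forall i, (g i).[1] = y 0 i &
         forall t, h.[t] != 0 -> X (\row_i (g i).[t])]) ->
  zariski_irreducible X.
Proof.
move=> X0 curves; split=> // F G [I ->] [J ->] XFG.
apply: contrapT => /not_orP [/existsNP [x /not_implyP [Xx Fx]]].
move=> /existsNP [y /not_implyP [Xy Gy]].
have /existsNP [p /not_implyP [Ip px]] := Fx.
have /existsNP [q /not_implyP [Jq qy]] := Gy.
have [g [h [h0 gx gy Xg]]] := curves x y Xx Xy.
have pb0 f t (z : 'rV[K]_m) : (forall i, (g i).[t] = z 0 i) ->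
    f.@[z 0] <> 0 -> pullback g f != 0.
  move=> gz fz; apply: contra_notN fz => /eqP f0.
  have := horner_pullback g f t; rewrite f0 horner0 => ->; exact: meval_eq.
have : pullback g p * pullback g q * h != 0.
  by rewrite !mulf_neq0 // ?(pb0 _ _ _ gx px) ?(pb0 _ _ _ gy qy).
case/closed_nonrootP => t; rewrite rootE !hornerM !mulf_eq0 !negb_or.
case/andP=> /andP[pt qt] /Xg Xgt.
have val f : (pullback g f).[t] = f.@[(\row_i (g i).[t] : 'rV[K]_m) 0].
  by rewrite horner_pullback; apply: meval_eq => i; rewrite mxE.
by case: (XFG _ Xgt) => [/(_ p Ip)|/(_ q Jq)]; rewrite -val; apply/eqP.
Qed.

Lemma zariski_irreducible1 (x : 'rV[K]_m) : zariski_irreducible [set x].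
Proof.
apply: zariski_irreducible_curves; first by exists x.
move=> _ _ -> ->; exists (fun i => (x 0 i)%:P), 1; split=> [|i|i|t _].
- exact: oner_neq0.
- by rewrite hornerC.
- by rewrite hornerC.
- by apply/rowP => i; rewrite mxE hornerC.
Qed.

(** The velocity of a curve in X is a tangent vector. *)
Lemma tangent_space_curve X (x : 'rV[K]_m) g (h : {poly K}) : h != 0 ->
  (forall i, (g i).[0] = x 0 i) ->
  (forall t, h.[t] != 0 -> X (\row_i (g i).[t])) ->
  tangent_space X x (\row_i (g i)^`().[0]).
Proof.
move=> h0 gx Xg f Xf.
have : pullback g f * h = 0.
  apply/eqP; apply: contraT => /closed_nonrootP [t].
  rewrite rootE hornerM mulf_eq0 negb_or => /andP[ft /Xg /Xf fg0].
  case/negP: ft; rewrite horner_pullback -fg0; apply/eqP; apply: meval_eq => i.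
  by rewrite mxE.
move/eqP; rewrite mulf_eq0 (negPf h0) orbF => /eqP f0.
have := deriv_pullback g f; rewrite f0 deriv0 => /(congr1 (horner_eval 0)).
rewrite /= horner_evalE horner0 horner_evalE horner_sum => e0.
rewrite [RHS]e0; apply: eq_bigr => i _.
rewrite hornerM horner_pullback mxE; congr (_ * _).
by apply: meval_eq => j; rewrite gx.
Qed.

Lemma differential_line (x v : 'rV[K]_m) f :
  \sum_(i < m) (mderiv i f).@[x 0] * v 0 i
  = (pullback (fun i => (x 0 i)%:P + (v 0 i)%:P * 'X) f)^`().[0].
Proof.
rewrite deriv_pullback horner_sum; apply: eq_bigr => i _.
rewrite hornerM horner_pullback derivD derivC add0r mul_polyC derivZ derivX.
rewrite -mul_polyC mulr1 hornerC.
congr (_ * _); apply: meval_eq => j.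
by rewrite hornerD hornerC hornerMX mulr0 addr0.
Qed.

Lemma exists_notin (s : seq K) : exists b, b \notin s.
Proof.
have /closed_nonrootP [b] : \prod_(a <- s) ('X - a%:P) != 0.
  by rewrite monic_neq0 // monic_prod_XsubC.
by rewrite root_prod_XsubC => nb; exists b.
Qed.

End Curves.

(** * The polynomial chi_4 *)

(** The polynomial P_4 at lambda = l, over any commutative ring. *)
Definition tridiag4 (A : comNzRingType) (l t : A) (a c : nat -> A) : A :=
  (l + a 1%N) * (l + a 2%N) * (l + a 3%N) * (l + a 4%N)
  - t * (c 1%N * (l + a 3%N) * (l + a 4%N) + c 2%N * (l + a 1%N) * (l + a 4%N)
         + c 3%N * (l + a 1%N) * (l + a 2%N)) + t ^+ 2 * (c 1%N * c 3%N).

Lemma rmorph_tridiag4 (A B : comNzRingType) (phi : {rmorphism A -> B})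
    l t a c l' t' a' c' :
  phi l = l' -> phi t = t' -> (forall i, phi (a i) = a' i) ->
  (forall i, phi (c i) = c' i) ->
  phi (tridiag4 l t a c) = tridiag4 l' t' a' c'.
Proof.
move=> <- <- ha hc.
by rewrite /tridiag4 -!ha -!hc !(rmorphB, rmorphD, rmorphM, rmorphXn).
Qed.

Lemma tridiag4_rec (A : comNzRingType) (l t : A) (a c : nat -> A) :
  (l + a 4%N) * ((l + a 3%N) *
        ((l + a 2%N) * (l + a 1%N) - t * c 1%N * 1)
        - t * c 2%N * (l + a 1%N))
    - t * c 3%N * ((l + a 2%N) * (l + a 1%N) - t * c 1%N * 1)
  = tridiag4 l t a c.
Proof. rewrite /tridiag4; ring. Qed.

Section Chi4.
Variable K : closedFieldType.
Variables a c : nat -> K.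

Lemma Ppoly4E : Ppoly a c 4 =
  tridiag4 'X 'X%:P (fun i => (a i)%:P%:P) (fun i => (c i)%:P%:P).
Proof. exact: tridiag4_rec. Qed.

Lemma map_comp_X2 :
  let phi := map_poly (comp_poly ('X^2 : {poly K})) in
  [/\ phi 'X = 'X, phi 'X%:P = ('X^2)%:P & forall b : K, phi b%:P%:P = b%:P%:P].
Proof.
split=> [||b] /=; first by rewrite map_polyX.
  by rewrite map_polyC /= comp_polyX.
by rewrite map_polyC /= comp_polyC.
Qed.

Lemma chi4E : chi a c 4 =
  tridiag4 'X ('X^2)%:P (fun i => (a i)%:P%:P) (fun i => (c i)%:P%:P).
Proof.
have [eX eY eC] := map_comp_X2; rewrite /chi Ppoly4E.
apply: (rmorph_tridiag4 (phi := map_poly (comp_poly ('X^2 : {poly K})))) => // i;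
  exact: eC.
Qed.

Lemma swap_chi4 : swapXY (chi a c 4) =
  tridiag4 'X%:P 'X^2 (fun i => (a i)%:P%:P) (fun i => (c i)%:P%:P).
Proof.
have sC (b : K) : swapXY b%:P%:P = b%:P%:P by rewrite swapXY_polyC map_polyC.
have sY : swapXY ('X^2)%:P = 'X^2 :> {poly {poly K}}.
  by rewrite swapXY_polyC map_polyXn.
(* Keeping the morphism abstract prevents unification from unfolding swapXY. *)
pose phi : {rmorphism {poly {poly K}} -> {poly {poly K}}} := @swapXY K.
have pX : phi 'X = 'X%:P by exact: swapXY_X.
have pY : phi ('X^2)%:P = 'X^2 by exact: sY.
have pC b : phi b%:P%:P = b%:P%:P by exact: sC.
rewrite -[LHS]/(phi (chi a c 4)) chi4E; clearbody phi.
exact: (rmorph_tridiag4 pX pY (fun i => pC (a i)) (fun i => pC (c i))).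
Qed.

(** The coefficients of 1 and - w^2 in chi_4. *)
Definition quartic : {poly K} :=
  ('X + (a 1%N)%:P) * ('X + (a 2%N)%:P) * ('X + (a 3%N)%:P) * ('X + (a 4%N)%:P).
Definition middle : {poly K} :=
  (c 1%N)%:P * ('X + (a 3%N)%:P) * ('X + (a 4%N)%:P)
   + (c 2%N)%:P * ('X + (a 1%N)%:P) * ('X + (a 4%N)%:P)
   + (c 3%N)%:P * ('X + (a 1%N)%:P) * ('X + (a 2%N)%:P).

Lemma swap_chi4_poly : swapXY (chi a c 4) =
  quartic%:P - middle%:P * 'X^2 + (c 1%N * c 3%N)%:P%:P * 'X^4.
Proof.
rewrite swap_chi4 /quartic /middle.
have e1 (p q : {poly K}) : (p * q)%:P = p%:P * q%:P by rewrite rmorphM.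
have e2 (p q : {poly K}) : (p + q)%:P = p%:P + q%:P by rewrite rmorphD.
have e3 (p q : K) : (p * q)%:P = p%:P * q%:P by rewrite rmorphM.
rewrite e3 !(e1, e2) /tridiag4.
move: (polyC 'X) ('X : {poly {poly K}}) => L X.
ring.
Qed.

End Chi4.

(** * Factors of an even quartic in w *)

Lemma coefM_low (R : comNzRingType) (p q : {poly R}) :
  [/\ (p * q)`_0 = p`_0 * q`_0, (p * q)`_1 = p`_0 * q`_1 + p`_1 * q`_0,
      (p * q)`_2 = p`_0 * q`_2 + p`_1 * q`_1 + p`_2 * q`_0 &
      (p * q)`_3 = p`_0 * q`_3 + p`_1 * q`_2 + p`_2 * q`_1 + p`_3 * q`_0].
Proof. by split; rewrite coefM !big_ord_recr big_ord0 /= add0r. Qed.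

Lemma polyC_mul_eq (K : fieldType) (f : K) (p q : {poly K}) :
  f != 0 -> f%:P * p = q -> p = f^-1%:P * q.
Proof. by move=> f0 <-; rewrite mulrA -polyCM mulVf // mul1r. Qed.

Lemma size_mul_leq (K : closedFieldType) (p q : {poly K}) i j k :
  (size p <= i)%N -> (size q <= j)%N -> ((i + j).-1 <= k)%N ->
  (size (p * q)%R <= k)%N.
Proof.
move=> pi qj ijk; apply: (leq_trans (size_polyMleq _ _)); apply: leq_trans ijk.
by rewrite -!subn1 leq_sub2r // leq_add.
Qed.

Lemma eq_three i j : (i + j = 6)%N -> ((i < j)%N -> (j <= 3)%N) ->
  ((j < i)%N -> (i <= 3)%N) -> i = 3%N /\ j = 3%N.
Proof. lia. Qed.

Section EvenFactor.
Variables (K : closedFieldType) (A Q : {poly K}) (c : K).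
Hypotheses (c0 : c != 0) (szA : size A = 5%N) (szQ : (size Q <= 3)%N).
Hypothesis sqfreeA : forall p q : {poly K}, p * p * q = A -> (size p <= 1)%N.

Let E : {poly {poly K}} := A%:P - Q%:P * 'X^2 + c%:P%:P * 'X^4.

Let size_E : size E = 5%N.
Proof.
have szc : size (c%:P%:P * 'X^4 : {poly {poly K}}) = 5%N.
  by rewrite mul_polyC size_scale ?polyC_eq0 // size_polyXn.
rewrite /E addrC size_polyDl szc // ltnS (leq_trans (size_polyD _ _)) //.
rewrite size_polyN.
rewrite geq_max (leq_trans (size_polyC_leq1 _)) //=.
apply: (leq_trans (size_polyMleq _ _)); rewrite size_polyXn addn3 /= ltnS.
by rewrite ltnS (leq_trans (size_polyC_leq1 _)).
Qed.

Let coef_E : [/\ E`_0 = A, E`_1 = 0, E`_2 = - Q, E`_3 = 0 & E`_4 = c%:P].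
Proof.
by rewrite /E; split; rewrite !(coefD, coefN, coefCM, coefXn, coefC) /=
  ?mulr0 ?mulr1 ?subr0 ?addr0 ?add0r ?sub0r.
Qed.

(** In the proof, the vanishing of the coefficient of w makes the square of F`_0
    divide A, so that F`_0 is constant, and the degree of A would be at most 2. *)
Lemma no_linear_factor (F G : {poly {poly K}}) (f g : K) :
  size F = 2%N -> size G = 4%N -> F`_1 = f%:P -> G`_3 = g%:P -> f != 0 ->
  F * G <> E.
Proof.
move=> sF sG F1 G3 f0 FG; have [e0 e1 e2 e3 _] := coef_E.
have [m0 m1 m2 m3] := coefM_low F G.
move: e0 e1 e2 e3; rewrite -FG m0 m1 m2 m3 F1 G3.
have -> : F`_2 = 0 by rewrite nth_default // sF.
have -> : F`_3 = 0 by rewrite nth_default // sF.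
rewrite !mul0r !addr0 => e0 e1 e2 e3.
have G0 : G`_0 = - (f^-1%:P * F`_0 * G`_1).
  rewrite [LHS](@polyC_mul_eq _ f _ (- (F`_0 * G`_1))) //; first by ring.
  by apply/eqP; rewrite -addr_eq0 addrC e1.
have G2 : G`_2 = - (f^-1%:P * F`_0 * g%:P).
  rewrite [LHS](@polyC_mul_eq _ f _ (- (F`_0 * g%:P))) //; first by ring.
  by apply/eqP; rewrite -addr_eq0 addrC e3.
have G1 : G`_1 = f^-1%:P * (- Q - F`_0 * G`_2).
  by apply: polyC_mul_eq => //; rewrite -e2; ring.
have szF0 : (size (F`_0)%R <= 1)%N.
  by apply: (sqfreeA (q := - (f^-1%:P * G`_1))); rewrite -e0 G0; ring.
have szG2 : (size (G`_2)%R <= 1)%N.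
  rewrite G2 size_polyN -mulrA mul_polyC (leq_trans (size_scale_leq _ _)) //.
  by rewrite mulrC mul_polyC (leq_trans (size_scale_leq _ _)).
have szG1 : (size (G`_1)%R <= 3)%N.
  rewrite G1 mul_polyC (leq_trans (size_scale_leq _ _)) //.
  rewrite (leq_trans (size_polyD _ _)) // !size_polyN geq_max szQ /=.
  by apply: (size_mul_leq szF0 szG2).
have szG0 : (size (G`_0)%R <= 3)%N.
  rewrite G0 size_polyN -mulrA mul_polyC (leq_trans (size_scale_leq _ _)) //.
  by apply: (size_mul_leq szF0 szG1).
have : (size A <= 3)%N by rewrite -e0; apply: (size_mul_leq szF0 szG0).
by rewrite szA.
Qed.

(** Both factors have degree 2 in w, and their coefficients of w vanish: otherwise
    their constant terms would be proportional and A not squarefree. *)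
Lemma even_factors (F G : {poly {poly K}}) :
  F \isn't a GRing.unit -> G \isn't a GRing.unit -> F * G = E ->
  exists f0 g0 : {poly K}, exists al be : K,
    [/\ f0 * g0 = A, al * be = c, al%:P * g0 + be%:P * f0 = - Q,
        size f0 = 3%N & size g0 = 3%N].
Proof.
move=> nF nG FG; have [e0 e1 e2 e3 e4] := coef_E.
have : E != 0 by rewrite -size_poly_eq0 size_E.
rewrite -FG mulf_eq0 negb_or => /andP [F0 G0].
have szFG : (size F + size G = 6)%N.
  rewrite -[6%N]/(5.+1) -size_E -FG size_mul // prednK //.
  by rewrite addn_gt0 size_poly_gt0 F0.
have lFG : lead_coef F * lead_coef G = c%:P.
  by rewrite -lead_coefM FG lead_coefE size_E.
have [lF lG] : size (lead_coef F) = 1%N /\ size (lead_coef G) = 1%N.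
  have : size (lead_coef F * lead_coef G) == 1%N by rewrite lFG size_polyC c0.
  by rewrite size_mul_eq1 => /andP [/eqP -> /eqP ->].
have lead_const (p : {poly {poly K}}) : size (lead_coef p) = 1%N ->
    exists2 f, f != 0 & lead_coef p = f%:P.
  by move=> /eqP /size_poly1P.
have size_gt1 (p : {poly {poly K}}) : size (lead_coef p) = 1%N ->
    p \isn't a GRing.unit -> (1 < size p)%N.
  move=> sp; rewrite ltnNge; apply: contra => p1.
  have [f f0 ef] := lead_const p sp.
  have sp1 : size p = 1%N.
    apply/eqP; rewrite eqn_leq p1 size_poly_gt0.
    by rewrite -lead_coef_eq0 -size_poly_eq0 sp.
  have pf : p`_0 = f%:P by rewrite -ef lead_coefE sp1.
  by rewrite !poly_unitE sp1 eqxx pf size_polyC f0 coefC eqxx unitfE.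
have F2 := size_gt1 _ lF nF; have G2 := size_gt1 _ lG nG.
have [f f0 ef] := lead_const _ lF; have [g g0 eg] := lead_const _ lG.
have [sF|sF|sF] : [\/ size F = 2%N, size F = 3%N | size F = 4%N].
- have : (size F <= 4)%N by lia.
  case: (size F) F2 => [|[|[|[|[|n]]]]] // _ _;
    by [constructor 1 | constructor 2 | constructor 3].
- have sG : size G = 4%N by lia.
  case: (@no_linear_factor F G f g) => //.
    by rewrite -ef lead_coefE sF.
  by rewrite -eg lead_coefE sG.
- have sG : size G = 3%N by lia.
  have Ff : F`_2 = f%:P by rewrite -ef lead_coefE sF.
  have Gg : G`_2 = g%:P by rewrite -eg lead_coefE sG.
  have [m0 m1 m2 m3] := coefM_low F G.
  move: e0 e1 e2 e3; rewrite -FG m0 m1 m2 m3 Ff Gg.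
  have -> : F`_3 = 0 by rewrite nth_default // sF.
  have -> : G`_3 = 0 by rewrite nth_default // sG.
  rewrite !mul0r !mulr0 !addr0 !add0r => e0 e1 e2 e3.
  have G1 : G`_1 = - ((f^-1%:P * g%:P) * F`_1).
    rewrite [LHS](@polyC_mul_eq _ f _ (- (F`_1 * g%:P))) //; first by ring.
    by apply/eqP; rewrite -addr_eq0 addrC e3.
  have F1 : F`_1 = 0.
    move/eqP: e1; rewrite G1.
    rewrite (_ : _ + _ = F`_1 * (G`_0 - f^-1%:P * g%:P * F`_0)); last by ring.
    rewrite mulf_eq0 => /orP [/eqP //|]; rewrite subr_eq0 => /eqP G0e.
    have sF0 : (size (F`_0)%R <= 1)%N.
      by apply: (sqfreeA (q := f^-1%:P * g%:P)); rewrite -e0 G0e; ring.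
    have : (size A <= 1)%N.
      rewrite -e0 G0e -polyCM mul_polyC -scalerAr.
      apply: (leq_trans (size_scale_leq _ _)).
      by apply: (size_mul_leq sF0 sF0).
    by rewrite szA.
  exists F`_0, G`_0, f, g; move: e2; rewrite F1 mul0r addr0 => e2.
  have e2' : f%:P * G`_0 + g%:P * F`_0 = - Q by rewrite -e2; ring.
  have [F00 G00] : F`_0 != 0 /\ G`_0 != 0.
    by apply/andP; rewrite -negb_or -mulf_eq0 e0 -size_poly_eq0 szA.
  have szM : (size (F`_0)%R + size (G`_0)%R = 6)%N.
    rewrite -[6%N]/(5.+1) -szA -e0 size_mul // prednK //.
    by rewrite addn_gt0 size_poly_gt0 F00.
  have sfG : size (f%:P * G`_0) = size G`_0 by rewrite mul_polyC size_scale.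
  have sgF : size (g%:P * F`_0) = size F`_0 by rewrite mul_polyC size_scale.
  have szS : (size (f%:P * G`_0 + g%:P * F`_0)%R <= 3)%N.
    by rewrite e2' size_polyN.
  have [sF3 sG3] : size F`_0 = 3%N /\ size G`_0 = 3%N.
    apply: (eq_three szM) => lt.
      by move: szS; rewrite size_polyDl sfG // sgF.
    by move: szS; rewrite addrC size_polyDl sgF // sfG.
  split=> //.
  by apply: polyC_inj; rewrite polyCM -ef -eg.
- have sG : size G = 2%N by lia.
  case: (@no_linear_factor G F g f) => //; last by rewrite mulrC.
    by rewrite -eg lead_coefE sG.
  by rewrite -ef lead_coefE sF.
Qed.

End EvenFactor.

(** * Equations of the reducible locus *)

(** The factorization that corresponds to the pairing 14|23. *)
Lemma tridiag4_factor (A : comNzRingType) (l t u : A) (a c : nat -> A) :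
  c 1%N = u * (a 2%N - a 1%N) * (a 4%N - a 1%N) ->
  c 2%N = u * (a 4%N - a 2%N) * (a 3%N - a 1%N) ->
  c 3%N = u * (a 4%N - a 3%N) * (a 4%N - a 1%N) ->
  tridiag4 l t a c =
    ((l + a 1%N) * (l + a 4%N) - t * (u * (a 4%N - a 1%N) ^+ 2)) *
    ((l + a 2%N) * (l + a 3%N) - t * (u * (a 4%N - a 3%N) * (a 2%N - a 1%N))).
Proof. by rewrite /tridiag4 => -> -> ->; ring. Qed.

Section ReducibleEquations.
Variable K : closedFieldType.
Implicit Types (al be l : K).

Section Matching.
Variables a1 a2 a3 a4 c1 c2 c3 : K.
Hypotheses (a12 : a1 != a2) (a13 : a1 != a3) (a14 : a1 != a4)
  (a23 : a2 != a3) (a24 : a2 != a4).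
Hypotheses (c10 : c1 != 0) (c20 : c2 != 0) (c30 : c3 != 0).

Let mid l := c1 * (l + a3) * (l + a4) + c2 * (l + a1) * (l + a4)
  + c3 * (l + a1) * (l + a2).

Let cancel (x y z : K) : x != y -> (y - x) * z = 0 -> z = 0.
Proof.
by move=> xy /eqP; rewrite mulf_eq0 subr_eq0 eq_sym (negPf xy) => /eqP.
Qed.

Let cancelr (x y z : K) : x != y -> (x - y) * z = 0 -> z = 0.
Proof. by rewrite eq_sym; apply: cancel. Qed.

(** The values at -a_1 and -a_4 give al = c1 and be = c3; the value at -a_2 then
    gives c2 = 0. *)
Lemma no_pairing12 al be :
  ~ (forall l, be * ((l + a1) * (l + a2)) + al * ((l + a3) * (l + a4)) = mid l).
Proof.
move=> H.
have e1 : al - c1 = 0.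
  apply: (cancel a13); apply: (cancel a14).
  by apply: etrans (subrr (mid (- a1))); rewrite -[X in _ = X - _]H /mid; ring.
have e4 : be - c3 = 0.
  apply: (cancelr a14); apply: (cancelr a24).
  by apply: etrans (subrr (mid (- a4))); rewrite -[X in _ = X - _]H /mid; ring.
have e2 : (a1 - a2) * ((a4 - a2) * c2) = 0.
  apply: etrans (subrr (mid (- a2))); rewrite -[X in _ = _ - X]H /mid.
  by rewrite (subr0_eq e1) (subr0_eq e4); ring.
have /(cancel a24) /eqP : (a4 - a2) * c2 = 0.
  exact: cancelr e2.
exact/negP.
Qed.

(** The values at -a_1 and -a_4 determine al and be, and al be = c1 c3 reads
    (a3 - a1) (a2 - a4) = (a2 - a1) (a3 - a4), that is (a2 - a3) (a4 - a1) = 0. *)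
Lemma no_pairing13 al be : al * be = c1 * c3 ->
  ~ (forall l, be * ((l + a1) * (l + a3)) + al * ((l + a2) * (l + a4)) = mid l).
Proof.
move=> albe H.
have e1 : al * (a2 - a1) - c1 * (a3 - a1) = 0.
  apply: (cancel a14).
  by apply: etrans (subrr (mid (- a1))); rewrite -[X in _ = X - _]H /mid; ring.
have e4 : be * (a3 - a4) - c3 * (a2 - a4) = 0.
  apply: (cancelr a14).
  by apply: etrans (subrr (mid (- a4))); rewrite -[X in _ = X - _]H /mid; ring.
have : (a2 - a3) * ((a4 - a1) * (c1 * c3)) = 0.
  transitivity ((c1 * (a3 - a1)) * (c3 * (a2 - a4))
                - c1 * c3 * (a2 - a1) * (a3 - a4)).
    by ring.
  by rewrite -(subr0_eq e1) -(subr0_eq e4) -albe; ring.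
move=> /(cancelr a23) /(cancel a14) /eqP.
by rewrite mulf_eq0 (negPf c10) (negPf c30).
Qed.

Lemma pairing14 al be : al * be = c1 * c3 ->
  (forall l, be * ((l + a1) * (l + a4)) + al * ((l + a2) * (l + a3)) = mid l) ->
  c1 * (a4 - a3) - c3 * (a2 - a1) = 0 /\
  c2 * (a4 - a1) * (a2 - a1) - c1 * (a4 - a2) * (a3 - a1) = 0.
Proof.
move=> albe H.
have e1 : al * (a2 - a1) - c1 * (a4 - a1) = 0.
  apply: (cancel a13).
  by apply: etrans (subrr (mid (- a1))); rewrite -[X in _ = X - _]H /mid; ring.
have e4 : al * (a3 - a4) - c3 * (a1 - a4) = 0.
  apply: (cancelr a24).
  by apply: etrans (subrr (mid (- a4))); rewrite -[X in _ = X - _]H /mid; ring.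
have e2 : be * (a1 - a2) - (c1 * (a3 - a2) + c2 * (a1 - a2)) = 0.
  apply: (cancel a24).
  by apply: etrans (subrr (mid (- a2))); rewrite -[X in _ = X - _]H /mid; ring.
have E1 : c1 * (a4 - a3) - c3 * (a2 - a1) = 0.
  apply: (cancel a14).
  transitivity ((c1 * (a4 - a1)) * (a4 - a3) + (c3 * (a1 - a4)) * (a2 - a1)).
    by ring.
  by rewrite -(subr0_eq e1) -(subr0_eq e4); ring.
split=> //.
have b4 : be * (a4 - a1) - c3 * (a2 - a1) = 0.
  apply: (cancel (x := 0) (y := c1)); first by rewrite eq_sym.
  transitivity (be * (c1 * (a4 - a1)) - (c1 * c3) * (a2 - a1)); first by ring.
  by rewrite -(subr0_eq e1) -albe; ring.
transitivity ((a4 - a1) * (be * (a1 - a2) - (c1 * (a3 - a2) + c2 * (a1 - a2)))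
   + (be * (a4 - a1) - c3 * (a2 - a1)) * (a2 - a1)
   - (c1 * (a4 - a3) - c3 * (a2 - a1)) * (a2 - a1)); first by ring.
by rewrite e2 b4 E1; ring.
Qed.

End Matching.

Section Chi.
Variables a c : nat -> K.
Hypotheses (a12 : a 1%N != a 2%N) (a13 : a 1%N != a 3%N) (a14 : a 1%N != a 4%N)
  (a23 : a 2%N != a 3%N) (a24 : a 2%N != a 4%N) (a34 : a 3%N != a 4%N).
Hypotheses (c10 : c 1%N != 0) (c20 : c 2%N != 0) (c30 : c 3%N != 0).

Lemma quarticE : quartic a = \prod_(i <- [:: 1; 2; 3; 4]%N) ('X - (- a i)%:P).
Proof. by rewrite !big_cons big_nil /quartic !polyCN !opprK; ring. Qed.

Lemma size_quartic : size (quartic a) = 5%N.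
Proof. by rewrite quarticE size_prod_XsubC. Qed.

Lemma size_middle : (size (middle a c) <= 3)%N.
Proof.
have sz (x y z : K) : (size (x%:P * ('X + y%:P) * ('X + z%:P))%R <= 3)%N.
  apply: (@size_mul_leq _ _ _ 2 2) => //; last by rewrite size_XaddC.
  by apply: (@size_mul_leq _ _ _ 1 2) => //; rewrite ?size_XaddC ?size_polyC_leq1.
rewrite /middle (leq_trans (size_polyD _ _)) // geq_max sz andbT.
by rewrite (leq_trans (size_polyD _ _)) // geq_max !sz.
Qed.

Lemma quartic_sqfree (p q : {poly K}) : p * p * q = quartic a -> (size p <= 1)%N.
Proof.
have : separable_poly (quartic a).
  rewrite quarticE -(big_map (fun i => - a i) predT (fun x => 'X - x%:P)).
  rewrite separable_prod_XsubC /=.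
  by rewrite !inE !eqr_opp !negb_or a12 a13 a14 a23 a24 a34.
case/separable_polyP => cop _ e; have := cop p p.
by rewrite -e dvdp_mulr // coprimepp => /(_ isT) /eqP ->.
Qed.

(** The coefficient of w^2 is that of (A_x A_y - al w^2) (A_z A_t - be w^2), with
    al be = c_1 c_3; polynomials in lambda are compared by their values. *)
Definition pairing x y z t := exists al be,
  al * be = c 1%N * c 3%N /\
  forall l, be * ((l + a x) * (l + a y)) + al * ((l + a z) * (l + a t))
    = c 1%N * (l + a 3%N) * (l + a 4%N) + c 2%N * (l + a 1%N) * (l + a 4%N)
      + c 3%N * (l + a 1%N) * (l + a 2%N).

Lemma pairing_sym x y z t : pairing x y z t -> pairing z t x y.
Proof.
move=> [al [be [albe H]]]; exists be, al; split=> [|l]; first by rewrite mulrC.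
by rewrite addrC.
Qed.

Lemma horner_middle l : (middle a c).[l] =
  c 1%N * (l + a 3%N) * (l + a 4%N) + c 2%N * (l + a 1%N) * (l + a 4%N)
  + c 3%N * (l + a 1%N) * (l + a 2%N).
Proof. by rewrite /middle !hornerE. Qed.

Let lin i : {poly K} := 'X - (- a i)%:P.

Let mask_pairs m : size (mask m [:: 1; 2; 3; 4]%N) = 2%N ->
  mask m [:: 1; 2; 3; 4]%N \in
  [:: [:: 1; 2]; [:: 1; 3]; [:: 1; 4]; [:: 2; 3]; [:: 2; 4]; [:: 3; 4]]%N.
Proof. by case: m => [|[] [|[] [|[] [|[] m]]]] //=; rewrite ?mask0. Qed.

(** A reducible chi_4 comes from one of the six choices of two of the four roots
    of its constant term. *)
Lemma chi4_reducible_pairing : reducible (chi a c 4) ->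
  [\/ pairing 1 2 3 4, pairing 1 3 2 4 | pairing 1 4 2 3].
Proof.
case=> _ _ [f [g [nf ng fg]]].
have c130 : c 1%N * c 3%N != 0 by rewrite mulf_neq0.
(* Keeping the morphism abstract prevents unification from unfolding swapXY. *)
pose phi : {rmorphism {poly {poly K}} -> {poly {poly K}}} := @swapXY K.
have phiK (p : {poly {poly K}}) : phi (phi p) = p by exact: swapXYK.
have phi_chi : phi (chi a c 4) = (quartic a)%:P - (middle a c)%:P * 'X^2
    + (c 1%N * c 3%N)%:P%:P * 'X^4 by exact: swap_chi4_poly.
clearbody phi.
have nunit (p : {poly {poly K}}) :
    p \isn't a GRing.unit -> phi p \isn't a GRing.unit.
  by apply: contra => /(rmorph_unit phi); rewrite phiK.
have FG : phi f * phi g = (quartic a)%:P - (middle a c)%:P * 'X^2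
    + (c 1%N * c 3%N)%:P%:P * 'X^4 by rewrite -phi_chi fg rmorphM.
have [f0 [g0 [al [be [e0 albe mid sf sg]]]]] :=
  even_factors c130 size_quartic size_middle quartic_sqfree
    (nunit f nf) (nunit g ng) FG.
have [m fm] : {m | f0 %= \prod_(i <- mask m [:: 1; 2; 3; 4]%N) lin i}.
  by apply: dvdp_prod_XsubC; rewrite -quarticE -e0 dvdp_mulr.
have sm : size (mask m [:: 1; 2; 3; 4]%N) = 2%N.
  by have := eqp_size fm; rewrite sf size_prod_XsubC => -[].
have q0 : quartic a != 0 by rewrite -size_poly_eq0 size_quartic.
have use_pair x y z t : mask m [:: 1; 2; 3; 4]%N == [:: x; y] ->
    quartic a = lin x * lin y * (lin z * lin t) -> pairing x y z t.
  move=> /eqP em qE; move: fm; rewrite em !big_cons big_nil mulr1.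
  set p := lin x * lin y in qE *; set p' := lin z * lin t in qE *.
  move=> /eqpf_eq [k k0 ef].
  have p0 : p != 0 by apply: contraNneq q0 => e; rewrite qE e mul0r.
  have eg : k *: g0 = p'.
    by apply: (mulfI p0); rewrite -qE -e0 ef -scalerAl scalerAr.
  exists (- (al / k)), (- (be * k)); split.
    by rewrite mulrNN mulrAC mulrA mulfK // mulrC.
  move=> l; rewrite -horner_middle.
  have hE i j : (lin i * lin j).[l] = (l + a i) * (l + a j).
    by rewrite hornerM !hornerXsubC !opprK.
  rewrite -!hE -/p -/p' {hE}; clearbody p p'.
  have h : al * g0.[l] + be * f0.[l] = - (middle a c).[l].
    by rewrite -hornerN -mid hornerD !hornerM !hornerC.
  by rewrite -[RHS]opprK -h ef -eg !hornerZ; field.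
have qE : quartic a = lin 1%N * lin 2%N * (lin 3%N * lin 4%N).
  by rewrite quarticE !big_cons big_nil -!/(lin _); ring.
have := mask_pairs sm; rewrite !inE.
case/orP => [/(use_pair 1 2 3 4)%N e|]; first by apply: Or31; apply: e.
case/orP => [/(use_pair 1 3 2 4)%N e|].
  by apply: Or32; apply: e; rewrite qE; ring.
case/orP => [/(use_pair 1 4 2 3)%N e|].
  by apply: Or33; apply: e; rewrite qE; ring.
case/orP => [/(use_pair 2 3 1 4)%N e|].
  by apply: Or33; apply: pairing_sym; apply: e; rewrite qE; ring.
case/orP => [/(use_pair 2 4 1 3)%N e|/(use_pair 3 4 1 2)%N e].
  by apply: Or32; apply: pairing_sym; apply: e; rewrite qE; ring.
by apply: Or31; apply: pairing_sym; apply: e; rewrite qE; ring.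
Qed.

Lemma chi4_reducible_eqs : reducible (chi a c 4) ->
  c 1%N * (a 4%N - a 3%N) - c 3%N * (a 2%N - a 1%N) = 0 /\
  c 2%N * (a 4%N - a 1%N) * (a 2%N - a 1%N)
    - c 1%N * (a 4%N - a 2%N) * (a 3%N - a 1%N) = 0.
Proof.
case/chi4_reducible_pairing => -[al [be [albe H]]].
- by case: (no_pairing12 a12 a13 a14 a24 c20 H).
- by case: (no_pairing13 a14 a23 c10 c30 albe H).
- exact: (pairing14 a13 a14 a24 c10 albe H).
Qed.

Lemma chi4_eqs_reducible u : c 1%N = u * (a 2%N - a 1%N) * (a 4%N - a 1%N) ->
  c 2%N = u * (a 4%N - a 2%N) * (a 3%N - a 1%N) ->
  c 3%N = u * (a 4%N - a 3%N) * (a 4%N - a 1%N) ->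
  reducible (chi a c 4).
Proof.
move=> e1 e2 e3.
pose W : {poly {poly K}} := ('X^2)%:P.
pose k (x : K) : {poly {poly K}} := x%:P%:P.
have kD x y : k (x - y) = k x - k y by rewrite /k !polyCB.
have kM x y : k (x * y) = k x * k y by rewrite /k !polyCM.
pose f := ('X + k (a 1%N)) * ('X + k (a 4%N))
  - W * (k u * (k (a 4%N) - k (a 1%N)) ^+ 2).
pose g := ('X + k (a 2%N)) * ('X + k (a 3%N))
  - W * (k u * (k (a 4%N) - k (a 3%N)) * (k (a 2%N) - k (a 1%N))).
have efg : chi a c 4 = f * g.
  rewrite chi4E; apply: tridiag4_factor;
    by rewrite -?[_%:P%:P]/(k _) ?(e1, e2, e3) !(kM, kD).
have root_nunit (p : {poly {poly K}}) (l : K) :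
    p.[l%:P].[0] = 0 -> p \isn't a GRing.unit.
  move=> p0; apply/negP => /unitrP [q [_ pq]].
  have : (p * q).[l%:P].[0] = 0 by rewrite !hornerM p0 mul0r.
  by rewrite pq !hornerC => /eqP; rewrite oner_eq0.
have nf : f \isn't a GRing.unit.
  apply: (root_nunit _ (- a 1%N)).
  by rewrite /f /W /k !hornerE /= expr0n addNr /= !mul0r subrr.
have ng : g \isn't a GRing.unit.
  apply: (root_nunit _ (- a 2%N)).
  by rewrite /g /W /k !hornerE /= expr0n addNr /= !mul0r subrr.
split.
- rewrite -swapXY_eq0 swap_chi4_poly.
  apply/eqP => /(congr1 (fun p : {poly {poly K}} => p`_4)) /eqP.
  rewrite coef0 !(coefD, coefN, coefCM, coefXn, coefC) /=.
  rewrite ?mulr0 ?subr0 ?add0r mulr1.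
  by rewrite polyC_eq0 mulf_eq0 (negPf c10) (negPf c30).
- by rewrite efg unitrM negb_and nf.
- by exists f, g.
Qed.

End Chi.

End ReducibleEquations.

(** The coordinates of the 7-dimensional space, counted from 0: a_1, ..., a_4 have
    the indices 0, ..., 3 and c_1, c_2, c_3 the indices 4, 5, 6. *)
Notation o_ k := (@Ordinal (4 + 4.-1) k isT).

Section Equations.
Variable A : comNzRingType.
Implicit Type v : 'I_(4 + 4.-1) -> A.

(** The expressions [disc], [eqn1], [eqn2] and [param] are defined over any
    commutative ring, to be used for points, for curves and for polynomials in
    the coordinates.  The stratum is the set of points where [disc] is nonzero. *)
Definition disc v : A :=
  (v (o_ 1) - v (o_ 0)) * (v (o_ 2) - v (o_ 0)) * (v (o_ 3) - v (o_ 0)) *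
  (v (o_ 2) - v (o_ 1)) * (v (o_ 3) - v (o_ 1)) * (v (o_ 3) - v (o_ 2)) *
  (v (o_ 4) * v (o_ 5) * v (o_ 6)).
(** The reducible locus is defined in the stratum by [eqn1] = [eqn2] = 0. *)
Definition eqn1 v : A :=
  v (o_ 4) * (v (o_ 3) - v (o_ 2)) - v (o_ 6) * (v (o_ 1) - v (o_ 0)).
Definition eqn2 v : A :=
  v (o_ 5) * (v (o_ 3) - v (o_ 0)) * (v (o_ 1) - v (o_ 0))
  - v (o_ 4) * (v (o_ 3) - v (o_ 1)) * (v (o_ 2) - v (o_ 0)).

(** The parametrization of the locus by a_1, ..., a_4 and u. *)
Definition param (a1 a2 a3 a4 u : A) (i : 'I_(4 + 4.-1)) : A :=
  nth 0 [:: a1; a2; a3; a4; u * (a2 - a1) * (a4 - a1);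
            u * (a4 - a2) * (a3 - a1); u * (a4 - a3) * (a4 - a1)] i.

Lemma eqn1_param a1 a2 a3 a4 u : eqn1 (param a1 a2 a3 a4 u) = 0.
Proof. by rewrite /eqn1 /param /=; ring. Qed.

Lemma eqn2_param a1 a2 a3 a4 u : eqn2 (param a1 a2 a3 a4 u) = 0.
Proof. by rewrite /eqn2 /param /=; ring. Qed.

End Equations.

Section EquationsMorphism.
Variables (A B : comNzRingType) (f : {rmorphism A -> B}).
Implicit Type v : 'I_(4 + 4.-1) -> A.

Lemma rmorph_disc v : f (disc v) = disc (f \o v).
Proof. by rewrite /disc !(rmorphM, rmorphB). Qed.

Lemma rmorph_eqn1 v : f (eqn1 v) = eqn1 (f \o v).
Proof. by rewrite /eqn1 !(rmorphM, rmorphB). Qed.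

Lemma rmorph_eqn2 v : f (eqn2 v) = eqn2 (f \o v).
Proof. by rewrite /eqn2 !(rmorphM, rmorphB). Qed.

End EquationsMorphism.

Lemma ord7_ind (P : 'I_(4 + 4.-1) -> Prop) :
  P (o_ 0) -> P (o_ 1) -> P (o_ 2) -> P (o_ 3) -> P (o_ 4) -> P (o_ 5) ->
  P (o_ 6) -> forall i, P i.
Proof.
by move=> p0 p1 p2 p3 p4 p5 p6; case=> [[|[|[|[|[|[|[|n]]]]]]] h] //;
  rewrite (bool_irrelevance h isT).
Qed.

Lemma big_ord7 (A : nmodType) (F : 'I_(4 + 4.-1) -> A) :
  \sum_i F i =
  F (o_ 0) + F (o_ 1) + F (o_ 2) + F (o_ 3) + F (o_ 4) + F (o_ 5) + F (o_ 6).
Proof.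
rewrite !big_ord_recl big_ord0 addr0 !addrA.
by do !congr (_ + _); congr F; apply: val_inj.
Qed.

Section Locus.
Variable K : closedFieldType.
Notation V := 'rV[K]_(4 + 4.-1).
Implicit Types (x y v p q : V).

Lemma disc_neq0P (v : 'I_(4 + 4.-1) -> K) : disc v != 0 <->
  [/\ v (o_ 1) - v (o_ 0) != 0, v (o_ 2) - v (o_ 0) != 0
    & v (o_ 3) - v (o_ 0) != 0] /\
  [/\ v (o_ 2) - v (o_ 1) != 0, v (o_ 3) - v (o_ 1) != 0
    & v (o_ 3) - v (o_ 2) != 0] /\
  [/\ v (o_ 4) != 0, v (o_ 5) != 0 & v (o_ 6) != 0].
Proof.
rewrite /disc !mulf_eq0 !negb_or; split.
  case/and3P=> /andP[/andP[/andP[/andP[/andP[-> ->] ->] ->] ->] ->].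
  by case/andP=> -> -> ->.
by case=> -[-> -> ->] [[-> -> ->] [-> -> ->]].
Qed.

Lemma stratum4E x : stratum x <-> disc (x 0) != 0.
Proof.
have L k (h : (k < 4)%N) (h' : (k < 4 + 4.-1)%N) :
    lsubmx x 0 (Ordinal h) = x 0 (Ordinal h').
  by rewrite mxE; congr (x 0 _); apply: val_inj.
have R : \prod_(i < 4.-1) rsubmx x 0 i = x 0 (o_ 4) * x 0 (o_ 5) * x 0 (o_ 6).
  rewrite !big_ord_recl big_ord0 mulr1 mulrA.
  by congr (_ * _ * _); rewrite mxE; congr (x 0 _); apply: val_inj.
rewrite /stratum /mkset R; split.
  case=> dist c123.
  have [c1 c2 c3] : [/\ x 0 (o_ 4) != 0, x 0 (o_ 5) != 0 & x 0 (o_ 6) != 0].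
    by move: c123; rewrite 2!mulf_eq0 2!negb_or => /andP[/andP[-> ->] ->].
  have d (i j : 'I_4) (h : (i < 4 + 4.-1)%N) (h' : (j < 4 + 4.-1)%N) :
      i != j -> x 0 (Ordinal h) - x 0 (Ordinal h') != 0.
    move=> /dist; case: i h => i hi h; case: j h' => j hj h'.
    by rewrite subr_eq0 (L _ _ h) (L _ _ h').
  apply/disc_neq0P; do !split => //.
  - exact: (d (@Ordinal 4 1 isT) (@Ordinal 4 0 isT)).
  - exact: (d (@Ordinal 4 2 isT) (@Ordinal 4 0 isT)).
  - exact: (d (@Ordinal 4 3 isT) (@Ordinal 4 0 isT)).
  - exact: (d (@Ordinal 4 2 isT) (@Ordinal 4 1 isT)).
  - exact: (d (@Ordinal 4 3 isT) (@Ordinal 4 1 isT)).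
  - exact: (d (@Ordinal 4 3 isT) (@Ordinal 4 2 isT)).
case/disc_neq0P => -[d1 d2 d3] [[d4 d5 d6] [c1 c2 c3]].
split; last by rewrite !mulf_neq0.
have wid k (h : (k < 4)%N) : (k < 4 + 4.-1)%N by exact: ltn_addr.
move=> [[|[|[|[|//]]]] hi] [[|[|[|[|//]]]] hj] // _; rewrite -subr_eq0;
  rewrite (L _ _ (wid _ hi)) (L _ _ (wid _ hj));
  rewrite (bool_irrelevance (wid _ hi) isT) (bool_irrelevance (wid _ hj) isT) //;
  by rewrite -oppr_eq0 opprB.
Qed.

Lemma entry_lsubmx x k (h : (k < 4 + 4.-1)%N) : (k < 4)%N ->
  entry (lsubmx x) k.+1 = x 0 (Ordinal h).
Proof.
move=> k4; rewrite /entry /= insubT mxE; congr (x 0 _); exact: val_inj.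
Qed.

Lemma entry_rsubmx x k (h : (4 + k < 4 + 4.-1)%N) :
  entry (rsubmx x) k.+1 = x 0 (Ordinal h).
Proof.
have k3 : (k < 4.-1)%N by move: h; rewrite ltn_add2l.
by rewrite /entry /= insubT mxE; congr (x 0 _); apply: val_inj.
Qed.

(** The value of the parameter u at a point of the locus. *)
Definition param_u (x : V) : K :=
  x 0 (o_ 4) / ((x 0 (o_ 1) - x 0 (o_ 0)) * (x 0 (o_ 3) - x 0 (o_ 0))).

Lemma eqns_param x : disc (x 0) != 0 -> eqn1 (x 0) = 0 -> eqn2 (x 0) = 0 ->
  x 0 =1 param (x 0 (o_ 0)) (x 0 (o_ 1)) (x 0 (o_ 2)) (x 0 (o_ 3)) (param_u x).
Proof.
case/disc_neq0P => -[d1 d2 d3] [[d4 d5 d6] [c1 c2 c3]] /subr0_eq e1 /subr0_eq e2.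
apply: ord7_ind; rewrite /param /param_u //=.
- by field; rewrite d1 d3.
- apply: (mulIf d1); apply: (mulIf d3).
  by rewrite mulrAC e2; field; rewrite d1 d3.
- by apply: (mulIf d1); rewrite -e1; field; rewrite d1 d3.
Qed.

(** The locus in coordinates: its points satisfy the two equations in the stratum. *)
Definition locus_eqs (x : V) : Prop :=
  [/\ disc (x 0) != 0, eqn1 (x 0) = 0 & eqn2 (x 0) = 0].

Lemma reducible_locus4E x : reducible_locus x <-> locus_eqs x.
Proof.
have eL k h := @entry_lsubmx x k h; have eR k h := @entry_rsubmx x k h.
have eqs_param := @eqns_param x.
split.
  case=> /stratum4E dx red.
  have /disc_neq0P [[d1 d2 d3] [[d4 d5 d6] [c1 c2 c3]]] := dx.
  have ne k l (h : (k < 4 + 4.-1)%N) (h' : (l < 4 + 4.-1)%N) :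
      (k < 4)%N -> (l < 4)%N -> x 0 (Ordinal h') - x 0 (Ordinal h) != 0 ->
      entry (lsubmx x) k.+1 != entry (lsubmx x) l.+1.
    by move=> k4 l4; rewrite (eL _ h) // (eL _ h') // subr_eq0 eq_sym.
  have := chi4_reducible_eqs (ne 0 1 isT isT isT isT d1)%N
    (ne 0 2 isT isT isT isT d2)%N (ne 0 3 isT isT isT isT d3)%N
    (ne 1 2 isT isT isT isT d4)%N (ne 1 3 isT isT isT isT d5)%N
    (ne 2 3 isT isT isT isT d6)%N _ _ _ red.
  rewrite (eL 0%N isT) // (eL 1%N isT) // (eL 2%N isT) // (eL 3%N isT) //.
  rewrite (eR 0%N isT) (eR 1%N isT) (eR 2%N isT) => /(_ c1 c2 c3) [e1 e2].
  by split.
case=> dx e1 e2; split; first exact/stratum4E.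
have /disc_neq0P [_ [_ [c1 c2 c3]]] := dx.
apply: (@chi4_eqs_reducible _ _ _ _ _ (param_u x)).
- by rewrite (eR 0%N isT).
- by rewrite (eR 2%N isT).
- rewrite (eR 0%N isT) (eL 0%N isT) // (eL 1%N isT) // (eL 3%N isT) //.
  by rewrite {1}eqs_param.
- rewrite (eR 1%N isT) (eL 0%N isT) // (eL 1%N isT) // (eL 2%N isT) //.
  rewrite (eL 3%N isT) //.
  by rewrite {1}eqs_param.
- rewrite (eR 2%N isT) (eL 0%N isT) // (eL 2%N isT) // (eL 3%N isT) //.
  by rewrite {1}eqs_param.
Qed.

End Locus.

(** * Irreducibility of the locus and of its slices *)

Lemma map_nth0 (A B : nmodType) (f : {additive A -> B}) (s : seq A) k :
  f (nth 0 s k) = nth 0 (map f s) k.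
Proof. by elim: s k => [|a s IHs] [|k] //=; rewrite raddf0. Qed.

Lemma uniq_replace4 (T : eqType) (x0 x1 x2 x3 b d : T) k
    (r := [:: x0; x1; x2; x3]) :
  uniq r -> b \notin r -> (k < 4)%N ->
  uniq [:: if 0 == k then b else nth d r 0; if 1 == k then b else nth d r 1;
           if 2 == k then b else nth d r 2; if 3 == k then b else nth d r 3]%N.
Proof.
rewrite /r /= !inE !negb_or !andbT => /and3P [/and3P [n1 n2 n3] /andP [n4 n5] n6].
move=> /and4P [m0 m1 m2 m3].
have [p0 p1 p2] : [/\ x0 != b, x1 != b & x2 != b] by rewrite ![_ == b]eq_sym.
case: k => [|[|[|[|//]]]] _ /=;
  by rewrite ?m0 ?m1 ?m2 ?m3 ?p0 ?p1 ?p2 ?n1 ?n2 ?n3 ?n4 ?n5 ?n6.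
Qed.

Section Geometry.
Variable K : closedFieldType.
Notation V := 'rV[K]_(4 + 4.-1).
Implicit Types (x y v p q : V) (a b t : K).

(** The line through a, at parameter 0, and b, at parameter 1. *)
Definition line a b : {poly K} := a%:P + (b - a)%:P * 'X.

Lemma horner_line a b t : (line a b).[t] = a + (b - a) * t.
Proof. by rewrite /line !hornerE. Qed.

Lemma horner_line0 a b : (line a b).[0] = a.
Proof. by rewrite horner_line mulr0 addr0. Qed.

Lemma horner_line1 a b : (line a b).[1] = b.
Proof. by rewrite horner_line mulr1 addrC subrK. Qed.

Lemma horner_disc (g : 'I_(4 + 4.-1) -> {poly K}) t :
  (disc g).[t] = disc ((\row_i (g i).[t] : V) 0).
Proof.
rewrite -[LHS]/(horner_eval t (disc g)) rmorph_disc.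
by congr disc; apply/funext => i; rewrite mxE.
Qed.

Lemma horner_eqn1 (g : 'I_(4 + 4.-1) -> {poly K}) t :
  (eqn1 g).[t] = eqn1 ((\row_i (g i).[t] : V) 0).
Proof.
rewrite -[LHS]/(horner_eval t (eqn1 g)) rmorph_eqn1.
by congr eqn1; apply/funext => i; rewrite mxE.
Qed.

Lemma horner_eqn2 (g : 'I_(4 + 4.-1) -> {poly K}) t :
  (eqn2 g).[t] = eqn2 ((\row_i (g i).[t] : V) 0).
Proof.
rewrite -[LHS]/(horner_eval t (eqn2 g)) rmorph_eqn2.
by congr eqn2; apply/funext => i; rewrite mxE.
Qed.

Lemma disc_curve_neq0 (g : 'I_(4 + 4.-1) -> {poly K}) x t :
  (forall i, (g i).[t] = x 0 i) -> disc (x 0) != 0 -> disc g != 0.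
Proof.
move=> gx; apply: contraNneq => g0; have := horner_disc g t; rewrite g0 horner0.
by move/esym/eqP; congr (disc _ == 0); apply/funext => i; rewrite mxE gx.
Qed.

Lemma horner_param (a1 a2 a3 a4 u : {poly K}) t i :
  (param a1 a2 a3 a4 u i).[t] =
  param a1.[t] a2.[t] a3.[t] a4.[t] u.[t] i.
Proof.
rewrite -[LHS]/(horner_eval t _) /param map_nth0 /=.
by rewrite !horner_evalE !(hornerM, hornerD, hornerN).
Qed.

Lemma param_curve_locus (a1 a2 a3 a4 u : {poly K}) t :
  (disc (param a1 a2 a3 a4 u)).[t] != 0 ->
  locus_eqs (\row_i (param a1 a2 a3 a4 u i).[t]).
Proof.
move=> dt; split; first by rewrite -horner_disc.
  by rewrite -horner_eqn1 eqn1_param horner0.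
by rewrite -horner_eqn2 eqn2_param horner0.
Qed.

(** The points of the locus with the same coordinates as x at the indices in P. *)
Definition slice x (P : pred nat) : set V :=
  [set y | locus_eqs y /\ forall i, P (val i) -> y 0 i = x 0 i].

(** Lines in the parameters (a, u) map to curves in the slice, as the indices in P
    are those of coordinates a_i, which are parameters. *)
Lemma slice_irreducible x (P : pred nat) : locus_eqs x ->
  (forall k, P k -> (k < 4)%N) -> zariski_irreducible (slice x P).
Proof.
move=> Rx P4; apply: zariski_irreducible_curves; first by exists x; split.
move=> p q [[dp p1 p2] xp] [[dq q1 q2] xq].
have pp := eqns_param dp p1 p2; have qq := eqns_param dq q1 q2.
pose g := param (line (p 0 (o_ 0)) (q 0 (o_ 0))) (line (p 0 (o_ 1)) (q 0 (o_ 1)))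
  (line (p 0 (o_ 2)) (q 0 (o_ 2))) (line (p 0 (o_ 3)) (q 0 (o_ 3)))
  (line (param_u p) (param_u q)).
have g0 i : (g i).[0] = p 0 i by rewrite horner_param !horner_line0 -pp.
have g1 i : (g i).[1] = q 0 i by rewrite horner_param !horner_line1 -qq.
exists g, (disc g); split=> //; first exact: (disc_curve_neq0 g0).
move=> t dt; split; first exact: param_curve_locus.
suff gl i : P (val i) -> (g i).[t] = p 0 i by move=> i Pi; rewrite mxE gl // xp.
move=> Pi; have := P4 _ Pi; have := xp _ Pi; rewrite -(xq _ Pi) {Pi}.
by move: i; apply: ord7_ind => //= e _;
  rewrite /g /param /= horner_line e subrr mul0r addr0.
Qed.

(** A hypersurface of the stratum that contains the locus. *)
Definition cutset : set V := [set x | disc (x 0) != 0 /\ eqn1 (x 0) = 0].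

Lemma disc_param a1 a2 a3 a4 u : uniq [:: a1; a2; a3; a4] -> u != 0 ->
  disc (param a1 a2 a3 a4 u) != 0.
Proof.
rewrite /= !inE !negb_or !andbT.
move=> /and3P [/and3P [n12 n13 n14] /andP [n23 n24] n34] u0.
apply/disc_neq0P; rewrite /param /=.
by do !split; rewrite ?mulf_neq0 // subr_eq0 eq_sym.
Qed.

Lemma param_locus a1 a2 a3 a4 u : uniq [:: a1; a2; a3; a4] -> u != 0 ->
  locus_eqs (\row_i param a1 a2 a3 a4 u i).
Proof.
have E : (\row_i param a1 a2 a3 a4 u i : V) 0 = param a1 a2 a3 a4 u.
  by apply/funext => i; rewrite mxE.
by move=> ua u0; split; rewrite E ?eqn1_param ?eqn2_param ?disc_param.
Qed.

Lemma exists_locus_point : exists x, locus_eqs x.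
Proof.
have [a1 _] := exists_notin ([::] : seq K).
have [a2 n2] := exists_notin [:: a1].
have [a3 n3] := exists_notin [:: a2; a1].
have [a4 n4] := exists_notin [:: a3; a2; a1].
exists (\row_i param a4 a3 a2 a1 1 i); apply: param_locus; rewrite ?oner_neq0 //.
by rewrite /= n2 n3 n4.
Qed.

Lemma stratum4_eq : @stratum K 4 = [set x | disc (x 0) != 0].
Proof. by apply/seteqP; split=> x /stratum4E. Qed.

Lemma disc_irreducible : zariski_irreducible [set x : V | disc (x 0) != 0].
Proof.
apply: zariski_irreducible_curves.
  by have [x [dx _ _]] := exists_locus_point; exists x.
move=> p q /= dp dq; pose g i := line (p 0 i) (q 0 i); exists g, (disc g).
split=> [|i|i|t]; rewrite /g ?horner_line0 ?horner_line1 // ?horner_disc //.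
by apply: (@disc_curve_neq0 _ p 0) => // i; rewrite horner_line0.
Qed.

Lemma cutset_irreducible : zariski_irreducible cutset.
Proof.
apply: zariski_irreducible_curves.
  by have [x [dx e1 _]] := exists_locus_point; exists x.
move=> p q [dp p1] [dq q1].
(* The hypersurface is parametrized by a, c_2 and s = c_1 / (a_2 - a_1), with
   c_1 = s (a_2 - a_1) and c_3 = s (a_4 - a_3). *)
pose s (x : V) := x 0 (o_ 4) / (x 0 (o_ 1) - x 0 (o_ 0)).
pose G (l : 'I_(4 + 4.-1) -> {poly K}) L (i : 'I_(4 + 4.-1)) : {poly K} :=
  nth 0 [:: l (o_ 0); l (o_ 1); l (o_ 2); l (o_ 3); L * (l (o_ 1) - l (o_ 0));
   l (o_ 5); L * (l (o_ 3) - l (o_ 2))] i.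
have Gx l L (x : V) t : disc (x 0) != 0 -> eqn1 (x 0) = 0 ->
    (forall k, (l k).[t] = x 0 k) -> L.[t] = s x -> forall i, (G l L i).[t] = x 0 i.
  move=> /disc_neq0P [[d1 d2 d3] _] /subr0_eq e1 lx Lx.
  apply: ord7_ind; rewrite /G /= ?hornerM ?hornerD ?hornerN ?lx ?Lx // /s.
    by field.
  by apply: (mulIf d1); rewrite -e1; field.
pose g := G (fun k => line (p 0 k) (q 0 k)) (line (s p) (s q)).
have g0 : forall i, (g i).[0] = p 0 i.
  by apply: Gx => // [k|]; rewrite horner_line0.
have g1 : forall i, (g i).[1] = q 0 i.
  by apply: Gx => // [k|]; rewrite horner_line1.
exists g, (disc g); split=> //; first exact: (disc_curve_neq0 g0).
move=> t dt; split; first by rewrite -horner_disc.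
rewrite -horner_eqn1 (_ : eqn1 g = 0) ?horner0 //.
by rewrite /eqn1 /g /G /=; ring.
Qed.

(** * Closed subsets *)

Lemma zariski_closed_poly (f : {mpoly K[4 + 4.-1]}) :
  zariski_closed [set x : V | f.@[x 0] = 0].
Proof.
exists [set f]; apply/seteqP; split=> x /=; first by move=> fx _ ->.
by move/(_ f erefl).
Qed.

Lemma meval_disc x :
  (disc (fun i => 'X_i : {mpoly K[4 + 4.-1]})).@[x 0] = disc (x 0).
Proof.
rewrite -[LHS]/(meval (x 0) _) rmorph_disc; congr disc.
by apply/funext => i /=; rewrite mevalXU.
Qed.

Lemma meval_eqn1 x :
  (eqn1 (fun i => 'X_i : {mpoly K[4 + 4.-1]})).@[x 0] = eqn1 (x 0).
Proof.
rewrite -[LHS]/(meval (x 0) _) rmorph_eqn1; congr eqn1.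
by apply/funext => i /=; rewrite mevalXU.
Qed.

Lemma meval_eqn2 x :
  (eqn2 (fun i => 'X_i : {mpoly K[4 + 4.-1]})).@[x 0] = eqn2 (x 0).
Proof.
rewrite -[LHS]/(meval (x 0) _) rmorph_eqn2; congr eqn2.
by apply/funext => i /=; rewrite mevalXU.
Qed.

Definition eqns_zero : set V := zero_set
  [set f | f = eqn1 (fun i => 'X_i) \/ f = eqn2 (fun i => 'X_i)].

Lemma eqns_zeroP x : eqns_zero x <-> eqn1 (x 0) = 0 /\ eqn2 (x 0) = 0.
Proof.
split=> [H|[e1 e2] f [->|->]]; rewrite ?meval_eqn1 ?meval_eqn2 //.
by rewrite -meval_eqn1 -meval_eqn2; split; apply: H; [left|right].
Qed.

Lemma locus_locally_closed : locally_closed (@locus_eqs K).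
Proof.
exists eqns_zero.
exists [set x | (disc (fun i => 'X_i : {mpoly K[4 + 4.-1]})).@[x 0] = 0]; split.
- by eexists.
- exact: zariski_closed_poly.
apply/seteqP; split=> x.
  case=> dx e1 e2; split; first exact/eqns_zeroP.
  by rewrite /= meval_disc; exact/eqP.
by case=> /eqns_zeroP [e1 e2] /=; rewrite meval_disc => /eqP dx.
Qed.

Lemma slice_closed x (P : pred nat) : closed_in (@locus_eqs K) (slice x P).
Proof.
exists (zero_set [set f | exists2 i : 'I_(4 + 4.-1),
    P (val i) & f = 'X_i - (x 0 i)%:MP]).
  by eexists.
apply/seteqP; split=> y [Ry H]; split=> //.
  by move=> _ [i Pi ->]; rewrite mevalB mevalXU mevalC H // subrr.
move=> i Pi; have := H ('X_i - (x 0 i)%:MP) (ex_intro2 _ _ i Pi erefl).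
by rewrite mevalB mevalXU mevalC => /subr0_eq.
Qed.

Lemma closed_in_self (X : set V) : closed_in X X.
Proof.
exists setT; last by rewrite setIT.
by exists set0; apply/seteqP; split=> // x _ f [].
Qed.

Lemma locus_closed_in_stratum :
  closed_in [set x : V | disc (x 0) != 0] (@locus_eqs K).
Proof.
exists eqns_zero; first by eexists.
apply/seteqP; split=> x; first by case=> dx e1 e2; split=> //; exact/eqns_zeroP.
by case=> dx /eqns_zeroP [e1 e2]; split.
Qed.

Lemma cutset_closed_in_stratum :
  closed_in [set x : V | disc (x 0) != 0] cutset.
Proof.
exists [set x | (eqn1 (fun i => 'X_i : {mpoly K[4 + 4.-1]})).@[x 0] = 0].
  exact: zariski_closed_poly.
by apply/seteqP; split=> x [dx] /=; rewrite meval_eqn1.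
Qed.

(** * A maximal chain through a point of the locus *)

(** First the point x, then the slice where a is fixed and u varies, then those
    where moreover a_1, a_2, a_3 and a_4 are successively released. *)
Definition flag x (k : nat) : set V :=
  if k is k'.+1 then slice x (fun i => (k' <= i < 4)%N) else [set x].

Lemma flag_chain x : locus_eqs x -> irr_chain (@locus_eqs K) 5 (flag x).
Proof.
move=> Rx; split=> [[|k] _|k lt_k5].
- split; last exact: zariski_irreducible1.
  have -> : flag x 0 = slice x xpredT.
    apply/seteqP; split=> y /=; first by move=> ->; split.
    by case=> _ e; apply/rowP => i; exact: e.
  exact: slice_closed.
- split; first exact: slice_closed.
  by apply: slice_irreducible => // i /andP[].
have [dx e1 e2] := Rx; have px := eqns_param dx e1 e2.
have /disc_neq0P [[d1 d2 d3] [[d4 d5 d6] [c1 c2 c3]]] := dx.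
have u0 : param_u x != 0 by rewrite /param_u !(mulf_neq0, invr_neq0).
split.
  case: k lt_k5 => [_ _ ->|k _ y [Ry H]]; first by split.
  by split=> // i /andP[ki i4]; apply: H; rewrite i4 (ltnW ki).
move=> sub.
(* The inclusions are strict: change u at the first step, and the released a_i,
   to a value different from all the a_j, at the others. *)
have xu : uniq [:: x 0 (o_ 0); x 0 (o_ 1); x 0 (o_ 2); x 0 (o_ 3)].
  have ne a b : a - b != 0 -> b != a by rewrite subr_eq0 eq_sym.
  by rewrite /= !inE !negb_or (ne _ _ d1) (ne _ _ d2) (ne _ _ d3) (ne _ _ d4)
    (ne _ _ d5) (ne _ _ d6).
case: k lt_k5 sub => [_|k k4] sub.
  have [u] := exists_notin [:: 0; param_u x].
  rewrite !inE negb_or => /andP [nu0 nux].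
  have /sub : flag x 1 (\row_i param (x 0 (o_ 0)) (x 0 (o_ 1)) (x 0 (o_ 2))
                                     (x 0 (o_ 3)) u i).
    by split; [exact: param_locus | apply: ord7_ind => //= _; rewrite mxE].
  move=> /= /(congr1 (fun y : V => y 0 (o_ 4))); rewrite mxE [RHS]px /param /=.
  by move=> /(mulIf d3) /(mulIf d1) /eqP; apply/negP.
pose r := [:: x 0 (o_ 0); x 0 (o_ 1); x 0 (o_ 2); x 0 (o_ 3)].
have [b nb] := exists_notin r.
pose s k' := if k' == k then b else nth 0 r k'.
pose y : V := \row_i param (s 0) (s 1) (s 2) (s 3) (param_u x) i.
have Ry : locus_eqs y.
  by apply: param_locus => //; apply: uniq_replace4.
have ys : forall i : 'I_(4 + 4.-1), (i < 4)%N -> y 0 i = s i.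
  by apply: ord7_ind => //= _; rewrite mxE.
have : flag x k.+2 y.
  split=> // i /andP [ki i4]; rewrite ys // /s; case: eqP => [e|_].
    by move: ki; rewrite /= e ltnn.
  by move: i i4 {ki}; apply: ord7_ind.
move=> /sub [_] yk.
have k7 : (k < 4 + 4.-1)%N by exact: leq_trans (k4 : (k < 4)%N) _.
have ebx : b = x 0 (Ordinal k7) by rewrite -yk /= ?leqnn // ys // /s eqxx.
case/negP: nb; rewrite ebx; have : (Ordinal k7 < 4)%N by [].
by move: (Ordinal k7); apply: ord7_ind => //= _; rewrite !inE eqxx ?orbT.
Qed.

(** * The tangent space of the locus *)

Section Tangent.
Variable x : V.
Hypothesis Rx : locus_eqs x.

(** The differentials of [eqn1] and [eqn2] at x. *)
Definition deqn1 v : K :=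
  v 0 (o_ 4) * (x 0 (o_ 3) - x 0 (o_ 2)) + x 0 (o_ 4) * (v 0 (o_ 3) - v 0 (o_ 2))
  - v 0 (o_ 6) * (x 0 (o_ 1) - x 0 (o_ 0)) - x 0 (o_ 6) * (v 0 (o_ 1) - v 0 (o_ 0)).
Definition deqn2 v : K :=
  v 0 (o_ 5) * (x 0 (o_ 3) - x 0 (o_ 0)) * (x 0 (o_ 1) - x 0 (o_ 0))
  + x 0 (o_ 5) * (v 0 (o_ 3) - v 0 (o_ 0)) * (x 0 (o_ 1) - x 0 (o_ 0))
  + x 0 (o_ 5) * (x 0 (o_ 3) - x 0 (o_ 0)) * (v 0 (o_ 1) - v 0 (o_ 0))
  - v 0 (o_ 4) * (x 0 (o_ 3) - x 0 (o_ 1)) * (x 0 (o_ 2) - x 0 (o_ 0))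
  - x 0 (o_ 4) * (v 0 (o_ 3) - v 0 (o_ 1)) * (x 0 (o_ 2) - x 0 (o_ 0))
  - x 0 (o_ 4) * (x 0 (o_ 3) - x 0 (o_ 1)) * (v 0 (o_ 2) - v 0 (o_ 0)).

Let affine_line v i : {poly K} := (x 0 i)%:P + (v 0 i)%:P * 'X.

Lemma pullback_eqn1 g :
  pullback g (eqn1 (fun i : 'I_(4 + 4.-1) => 'X_i)) = eqn1 g :> {poly K}.
Proof.
rewrite rmorph_eqn1; congr eqn1.
by apply/funext => i /=; rewrite pullbackX.
Qed.

Lemma pullback_eqn2 g :
  pullback g (eqn2 (fun i : 'I_(4 + 4.-1) => 'X_i)) = eqn2 g :> {poly K}.
Proof.
rewrite rmorph_eqn2; congr eqn2.
by apply/funext => i /=; rewrite pullbackX.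
Qed.

Let deriv_affine_line v i : ((affine_line v i)^`() = (v 0 i)%:P).
Proof. by rewrite derivD derivC add0r mul_polyC derivZ derivX alg_polyC. Qed.

Let affine_line0 v i : (affine_line v i).[0] = x 0 i.
Proof. by rewrite hornerD hornerC hornerMX mulr0 addr0. Qed.

Lemma tangent_deqns v :
  tangent_space (@locus_eqs K) x v -> deqn1 v = 0 /\ deqn2 v = 0.
Proof.
move=> Tv; split.
  have I1 : vanishing_ideal (@locus_eqs K)
      (eqn1 (fun i : 'I_(4 + 4.-1) => 'X_i)).
    by move=> y [_ e1 _]; rewrite meval_eqn1.
  rewrite -[RHS](Tv _ I1) differential_line pullback_eqn1 -/(affine_line v).
  move: (affine_line v) (affine_line0 v) (deriv_affine_line v) => l l0 dl.
  rewrite /eqn1 !(derivD, derivN, derivM) !dl.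
  by rewrite !(hornerD, hornerN, hornerM, hornerC) !l0 /deqn1; ring.
have I2 : vanishing_ideal (@locus_eqs K)
    (eqn2 (fun i : 'I_(4 + 4.-1) => 'X_i)).
  by move=> y [_ _ e2]; rewrite meval_eqn2.
rewrite -[RHS](Tv _ I2) differential_line pullback_eqn2 -/(affine_line v).
move: (affine_line v) (affine_line0 v) (deriv_affine_line v) => l l0 dl.
rewrite /eqn2 !(derivD, derivN, derivM) !dl.
by rewrite !(hornerD, hornerN, hornerM, hornerC) !l0 /deqn2; ring.
Qed.

(** A vector killed by both differentials is the velocity of the curve given by
    affine functions of the parameters (a, u). *)
Lemma deqns_tangent v :
  deqn1 v = 0 -> deqn2 v = 0 -> tangent_space (@locus_eqs K) x v.
Proof.
move=> dv1 dv2; have [dx e1 e2] := Rx; have px := eqns_param dx e1 e2.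
have /disc_neq0P [[d1 d2 d3] [[d4 d5 d6] [c1 c2 c3]]] := dx.
have [l l0 dl] : exists2 l : 'I_(4 + 4.-1) -> {poly K},
    forall i, (l i).[0] = x 0 i & forall i, (l i)^`() = (v 0 i)%:P.
  by exists (affine_line v).
pose u := param_u x.
(* The velocity u' of u is chosen so that the velocity of
   c_1 = u (a_2 - a_1) (a_4 - a_1) is the coordinate of v of index 4. *)
pose u' := (v 0 (o_ 4) - u * ((v 0 (o_ 1) - v 0 (o_ 0)) * (x 0 (o_ 3) - x 0 (o_ 0))
      + (x 0 (o_ 1) - x 0 (o_ 0)) * (v 0 (o_ 3) - v 0 (o_ 0))))
   / ((x 0 (o_ 1) - x 0 (o_ 0)) * (x 0 (o_ 3) - x 0 (o_ 0))).
pose L := u%:P + u'%:P * 'X.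
pose g := param (l (o_ 0)) (l (o_ 1)) (l (o_ 2)) (l (o_ 3)) L.
have L0 : L.[0] = u by rewrite hornerD hornerC hornerMX mulr0 addr0.
have dL : L^`() = u'%:P.
  by rewrite derivD derivC add0r mul_polyC derivZ derivX alg_polyC.
have g0 i : (g i).[0] = x 0 i by rewrite horner_param !l0 L0 -px.
suff -> : v = \row_i (g i)^`().[0].
  apply: (tangent_space_curve (disc_curve_neq0 g0 dx)) => // t.
  exact: param_curve_locus.
clearbody L.
have x4 : x 0 (o_ 4) = u * (x 0 (o_ 1) - x 0 (o_ 0)) * (x 0 (o_ 3) - x 0 (o_ 0)).
  by rewrite px.
have x5 : x 0 (o_ 5) = u * (x 0 (o_ 3) - x 0 (o_ 1)) * (x 0 (o_ 2) - x 0 (o_ 0)).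
  by rewrite px.
have x6 : x 0 (o_ 6) = u * (x 0 (o_ 3) - x 0 (o_ 2)) * (x 0 (o_ 3) - x 0 (o_ 0)).
  by rewrite px.
apply/rowP; apply: ord7_ind; rewrite mxE /g /param /=.
- by rewrite dl hornerC.
- by rewrite dl hornerC.
- by rewrite dl hornerC.
- by rewrite dl hornerC.
- rewrite !(derivD, derivN, derivM) !dl dL.
  rewrite !(hornerD, hornerN, hornerM, hornerC) !l0 L0 /u'.
  by field; rewrite d1 d3.
- rewrite !(derivD, derivN, derivM) !dl dL.
  rewrite !(hornerD, hornerN, hornerM, hornerC) !l0 L0.
  apply: (mulIf d1); apply: (mulIf d3); apply/eqP; rewrite -subr_eq0; apply/eqP.
  rewrite -[RHS]dv2 /deqn2 x4 x5 /u'.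
  by field; rewrite d1 d3.
- rewrite !(derivD, derivN, derivM) !dl dL.
  rewrite !(hornerD, hornerN, hornerM, hornerC) !l0 L0.
  apply: (mulIf d1); apply/eqP; rewrite -subr_eq0; apply/eqP.
  rewrite -[RHS]oppr0 -dv1 /deqn1 x4 x6 /u'.
  by field; rewrite d1 d3.
Qed.

(** The matrix of the pair of differentials, acting on row vectors. *)
Definition deqn_mx : 'M[K]_(4 + 4.-1, 2) := \matrix_(i, j)
  if j == 0 then
    nth 0 [:: x 0 (o_ 6); - x 0 (o_ 6); - x 0 (o_ 4); x 0 (o_ 4);
      x 0 (o_ 3) - x 0 (o_ 2); 0; - (x 0 (o_ 1) - x 0 (o_ 0))] i
  else
    nth 0 [:: - x 0 (o_ 5) * (x 0 (o_ 1) - x 0 (o_ 0))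
        - x 0 (o_ 5) * (x 0 (o_ 3) - x 0 (o_ 0))
        + x 0 (o_ 4) * (x 0 (o_ 3) - x 0 (o_ 1));
      x 0 (o_ 5) * (x 0 (o_ 3) - x 0 (o_ 0))
        + x 0 (o_ 4) * (x 0 (o_ 2) - x 0 (o_ 0));
      - x 0 (o_ 4) * (x 0 (o_ 3) - x 0 (o_ 1));
      x 0 (o_ 5) * (x 0 (o_ 1) - x 0 (o_ 0))
        - x 0 (o_ 4) * (x 0 (o_ 2) - x 0 (o_ 0));
      - (x 0 (o_ 3) - x 0 (o_ 1)) * (x 0 (o_ 2) - x 0 (o_ 0));
      (x 0 (o_ 3) - x 0 (o_ 0)) * (x 0 (o_ 1) - x 0 (o_ 0)); 0] i.

Lemma deqn_mx0 v : (v *m deqn_mx) 0 0 = deqn1 v.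
Proof. by rewrite mxE big_ord7 !mxE /= /deqn1; ring. Qed.

Lemma deqn_mx1 v : (v *m deqn_mx) 0 1 = deqn2 v.
Proof. by rewrite mxE big_ord7 !mxE /= /deqn2; ring. Qed.

Lemma tangent_space_locus : exists2 T : {vspace V},
  (forall v, v \in T <-> tangent_space (@locus_eqs K) x v) & \dim T = 5%N.
Proof.
pose f : 'Hom(V, 'rV[K]_2) := linfun (mulmxr deqn_mx).
have fE v : f v = v *m deqn_mx by rewrite lfunE.
exists (lker f).
  move=> v; rewrite memv_ker fE; split=> [/eqP e|/tangent_deqns [t1 t2]].
    by apply: deqns_tangent; rewrite -?deqn_mx0 -?deqn_mx1 e mxE.
  apply/eqP/rowP => j; rewrite [RHS]mxE; case: j => [[|[|//]]] lj.
    by rewrite -[RHS]t1 -deqn_mx0; congr (_ 0 _); apply: val_inj.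
  by rewrite -[RHS]t2 -deqn_mx1; congr (_ 0 _); apply: val_inj.
have [dx _ _] := Rx; have /disc_neq0P [[d1 d2 d3] _] := dx.
(* The coefficients of dc_3 in the first differential, of dc_2 in the second one,
   are nonzero, and those of dc_2 in the first, of dc_3 in the second, are 0. *)
have full : limg f = fullv.
  apply/vspaceP => w; rewrite memvf.
  pose v : V := \row_i nth 0 [:: 0; 0; 0; 0; 0;
     w 0 1 / ((x 0 (o_ 3) - x 0 (o_ 0)) * (x 0 (o_ 1) - x 0 (o_ 0)));
     - w 0 0 / (x 0 (o_ 1) - x 0 (o_ 0))] i.
  have -> : w = f v; last by rewrite memv_img ?memvf.
  rewrite fE; apply/rowP => j; case: j => [[|[|//]]] lj.
    rewrite (_ : Ordinal lj = 0); last exact: val_inj.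
    by rewrite deqn_mx0 /deqn1 !mxE /=; field.
  rewrite (_ : Ordinal lj = 1); last exact: val_inj.
  by rewrite deqn_mx1 /deqn2 !mxE /=; field; rewrite d1 d3.
have := limg_ker_dim f fullv; rewrite capfv full !dimvf /dim /= => h.
by apply/eqP; rewrite -(eqn_add2r 2) -[X in (_ + X)%N](mul1n 2) h.
Qed.

End Tangent.

(** * Dimension and codimension of the locus *)

(** The locus, the hypersurface and the stratum; the values beyond index 2 are
    not used. *)
Definition stratum_flag (k : nat) : set V :=
  match k with
  | 0 => @locus_eqs K
  | 1 => cutset
  | _ => [set x | disc (x 0) != 0]
  end.

Lemma locus_irreducible : zariski_irreducible (@locus_eqs K).
Proof.
have [x Rx] := exists_locus_point.
have -> : @locus_eqs K = slice x xpred0.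
  by apply/seteqP; split=> // y [].
exact: slice_irreducible.
Qed.

Lemma stratum_flag_chain :
  irr_chain [set x : V | disc (x 0) != 0] 2 stratum_flag.
Proof.
have [x Rx] := exists_locus_point; have [dx e1 e2] := Rx.
have /disc_neq0P [[d1 d2 d3] [[d4 d5 d6] [c1 c2 c3]]] := dx.
(* Changing c_2, then c_3, at a point of the locus shows that the inclusions are
   strict. *)
pose upd k b : V := \row_(i < 4 + 4.-1) if val i == k then b else x 0 i.
split=> [[|[|[|//]]] _|[|[|//]] _].
- by split; [exact: locus_closed_in_stratum | exact: locus_irreducible].
- by split; [exact: cutset_closed_in_stratum | exact: cutset_irreducible].
- by split; [exact: closed_in_self | exact: disc_irreducible].
- split; first by move=> y [].
  have [b] := exists_notin [:: 0; x 0 (o_ 5)].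
  rewrite !inE negb_or => /andP [b0 bx].
  have Zb : cutset (upd 5 b).
    by split; [apply/disc_neq0P | rewrite -[RHS]e1 /eqn1]; rewrite !mxE.
  move=> /(_ _ Zb) [_ _]; rewrite -e2 /eqn2 !mxE /=.
  by move=> /addIr /(mulIf d1) /(mulIf d3) /eqP; apply/negP.
- split; first by move=> y [].
  have [b] := exists_notin [:: 0; x 0 (o_ 6)].
  rewrite !inE negb_or => /andP [b0 bx].
  have Ub : [set x : V | disc (x 0) != 0] (upd 6 b).
    by rewrite /mkset; apply/disc_neq0P; rewrite !mxE.
  move=> /(_ _ Ub) [_]; rewrite -e1 /eqn1 !mxE /=.
  by move=> /addrI /oppr_inj /(mulIf d1) /eqP; apply/negP.
Qed.

(** The upper bound comes from the chain above the locus, the lower bound from a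
    chain below it. *)
Lemma trdeg_locus : trdeg (@locus_eqs K) = 5%N.
Proof.
apply/eqP; rewrite eqn_leq; apply/andP; split.
  rewrite -(leq_add2r 2); apply: leq_trans (irr_chain_trdeg stratum_flag_chain) _.
  exact: trdeg_le.
have [x Rx] := exists_locus_point.
apply: (@leq_trans (trdeg (flag x 5))); last by apply: trdeg_subset => y [].
by apply: leq_trans (irr_chain_trdeg (flag_chain Rx)); rewrite leq_addl.
Qed.

Lemma locus_chain_length e S : irr_chain (@locus_eqs K) e S -> (e <= 5)%N.
Proof.
move=> chS; have [[F _ eF] _] := chS.1 e (leqnn e).
rewrite -trdeg_locus; apply: (@leq_trans (trdeg (S e))).
  by apply: leq_trans (irr_chain_trdeg chS); rewrite leq_addl.
by apply: trdeg_subset; rewrite eF => y [].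
Qed.

Lemma reducible_locus4_eq : @reducible_locus K 4 = @locus_eqs K.
Proof. by apply/seteqP; split=> x /reducible_locus4E. Qed.

Theorem reducible_locus4_smooth_irreducible :
  [/\ smooth (@reducible_locus K 4),
      zariski_irreducible (@reducible_locus K 4),
      has_dim (@reducible_locus K 4) 5 &
      has_codim (@reducible_locus K 4) (@stratum K 4) 2].
Proof.
rewrite reducible_locus4_eq stratum4_eq; split.
- split=> [|x Rx]; first exact: locus_locally_closed.
  have [T TE dT] := tangent_space_locus Rx; exists T; split=> //; rewrite dT.
  split=> [|e [S chS _]]; last exact: locus_chain_length chS.
  by exists (flag x) => //; exact: flag_chain.
- exact: locus_irreducible.
- split=> [|e [S chS]]; last exact: locus_chain_length chS.
  by have [x Rx] := exists_locus_point; exists (flag x); exact: flag_chain.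
- split=> [|e [S chS S0]].
    by exists stratum_flag => //; exact: stratum_flag_chain.
  have := irr_chain_trdeg chS; rewrite S0 trdeg_locus => le_e.
  by rewrite -(leq_add2l 5); apply: leq_trans le_e (trdeg_le _).
Qed.

End Geometry.

Theorem corollary4p4 (R : realType) :
  [/\ smooth (@reducible_locus R[i] 4),
      zariski_irreducible (@reducible_locus R[i] 4),
      has_dim (@reducible_locus R[i] 4) 5 &
      has_codim (@reducible_locus R[i] 4) (@stratum R[i] 4) 2].
Proof. exact: reducible_locus4_smooth_irreducible. Qed.
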